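(* Let $\sigma=\{\sigma_i \mid i\in I\}$ be a partition of the set $\mathbb{P}$ of all primes. Let $G$ be a finite $\sigma$-full group of Sylow type, let $E$ be a normal subgroup of $G$, and let $\mathcal{H}$ be a complete Hall $\sigma$-set of $G$ such that every member of $\mathcal{H}$ is supersoluble. Suppose that for every $\sigma_i\in\sigma(E)$ and every non-cyclic Hall $\sigma_i$-subgroup $K$ of $E$, the following hold: (a) every cyclic subgroup $H$ of $K$ of prime order is weakly $m$-$\mathcal{H}$-permutable in $G$; and (b) if the Sylow $2$-subgroups of $E$ are non-abelian, then every cyclic subgroup $H$ of $K$ of order $4$ with $H\nleq Z_\infty(G)$ is weakly $m$-$\mathcal{H}$-permutable in $G$. Then $E$ is hypercyclically embedded in $G$ (written $E\leq Z_{\mathfrak{U}}(G)$).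
   Context: All groups are finite. $\pi(G)$ is the set of primes dividing $|G|$. $\sigma=\{\sigma_i\mid i\in I\}$ is a partition of the set $\mathbb{P}$ of all primes, and $\sigma(G)=\{\sigma_i \mid \sigma_i\cap\pi(G)\neq\emptyset\}$. A group is $\sigma$-primary if $|\sigma(G)|\le 1$. A $\sigma_i$-subgroup is a subgroup whose order is divisible only by primes in $\sigma_i$; a Hall $\sigma_i$-subgroup is a $\sigma_i$-subgroup whose index is divisible by no prime in $\sigma_i$. A set $\mathcal{H}$ of subgroups of $G$ is a complete Hall $\sigma$-set of $G$ if every non-identity member of $\mathcal{H}$ is a Hall $\sigma_i$-subgroup of $G$ for some $i$ and $\mathcal{H}$ contains exactly one Hall $\sigma_i$-subgroup of $G$ for every $\sigma_i\in\sigma(G)$. $G$ is a $\sigma$-full group of Sylow type if every subgroup of $G$ is a $D_{\sigma_i}$-group for all $\sigma_i\in\sigma(G)$; here a group $X$ is a $D_{\sigma_i}$-group if it has a Hall $\sigma_i$-subgroup, any two Hall $\sigma_i$-subgroups of $X$ are conjugate in $X$, and every $\sigma_i$-subgroup of $X$ is contained in some Hall $\sigma_i$-subgroup of $X$. For $A\le B$, $A_B$ denotes the largest normal subgroup of $B$ contained in $A$. A subgroup $A$ of $G$ is $\sigma$-subnormal in $G$ if there is a chain $A=A_0\le A_1\le\cdots\le A_n=G$ such that for each $i\in\{1,\dots,n\}$ either $A_{i-1}$ is normal in $A_i$ or $A_i/(A_{i-1})_{A_i}$ is $\sigma$-primary. A subgroup $M$ of $G$ is modular in $G$ (in the sense of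 Kurosh) if it is a modular element of the subgroup lattice of $G$: $\langle X, M\cap Z\rangle=\langle X,M\rangle\cap Z$ for all $X\le Z\le G$, and $\langle M,Y\cap Z\rangle=\langle M,Y\rangle\cap Z$ for all $Y,Z\le G$ with $M\le Z$. Let $\mathcal{H}$ be a complete Hall $\sigma$-set of $G$. A subgroup $H$ of $G$ is $\mathcal{H}$-permutable if $HA=AH$ for all $A\in\mathcal{H}$. $H$ is $m$-$\mathcal{H}$-permutable in $G$ if $H=\langle A,B\rangle$ for some modular subgroup $A$ of $G$ and some $\mathcal{H}$-permutable subgroup $B$ of $G$. $H$ is weakly $m$-$\mathcal{H}$-permutable in $G$ if there is a $\sigma$-subnormal subgroup $T$ of $G$ with $G=HT$ and $H\cap T\le S\le H$ for some $m$-$\mathcal{H}$-permutable subgroup $S$ of $G$. $Z_\infty(G)$ is the hypercentre of $G$ (the last term of the upper central series). A normal subgroup $E$ of $G$ is hypercyclically embedded in $G$, written $E\le Z_{\mathfrak{U}}(G)$, if either $E=1$, or $E\ne1$ and every chief factor of $G$ below $E$ (i.e. every chief factor $L/K$ of $G$ with $L\le E$) is cyclic. *)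

(* Defs.v *)
From mathcomp Require Import all_boot all_fingroup all_solvable.

Set Implicit Arguments.
Unset Strict Implicit.
Unset Printing Implicit Defensive.

Local Open Scope group_scope.

(* The last two conditions give exactly one block for each prime; together    *)
(* with nonemptiness, the last one also makes the indexing injective.         *)
Definition prime_partition (I : Type) (sigma : I -> nat_pred) : Prop :=
  [/\ forall i, exists p, p \in sigma i,
      forall i p, p \in sigma i -> prime p,
      forall p, prime p -> exists i, p \in sigma i
    & forall i j p, p \in sigma i -> p \in sigma j -> i = j].

Section Sigma.

Variables (I : Type) (sigma : I -> nat_pred).

(* sigma(A) as a set of indices, for A a group. *)
Definition sigma_of (gT : finGroupType) (A : {set gT}) (i : I) : Prop :=
  exists p, p \in sigma i /\ p \in \pi(A).

Definition sigma_primary (gT : finGroupType) (A : {set gT}) : Prop :=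
  forall i j, sigma_of A i -> sigma_of A j -> i = j.

Variable gT : finGroupType.
Implicit Types (A B E G H K L M S T X Y Z : {group gT}).
Implicit Type HS : {set {group gT}}.

Definition complete_Hall_sigma_set G HS : Prop :=
  [/\ forall H, H \in HS -> H \subset G,
      forall H, H \in HS -> H :!=: 1 -> exists i, (sigma i).-Hall(G) H
    & forall i, sigma_of G i ->
        exists! H : {group gT}, H \in HS /\ (sigma i).-Hall(G) H].

Definition D_group (pi : nat_pred) X : Prop :=
  [/\ exists H, pi.-Hall(X) H,
      forall H K, pi.-Hall(X) H -> pi.-Hall(X) K ->
        exists2 x, x \in X & K :=: H :^ x
    & forall L, L \subset X -> pi.-group L ->
        exists2 H, pi.-Hall(X) H & L \subset H].

Definition sigma_full_Sylow_type G : Prop :=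
  forall X, X \subset G -> forall i, sigma_of G i -> D_group (sigma i) X.

Definition sigma_subnormal A G : Prop :=
  exists n (C : nat -> {group gT}),
    [/\ C 0%N = A, C n = G
      & forall i, (i < n)%N ->
          C i \subset C i.+1 /\
          (C i <| C i.+1 \/ sigma_primary (C i.+1 / gcore (C i) (C i.+1)))].

Definition modular_subgroup M G : Prop :=
  [/\ M \subset G,
      forall X Z, X \subset Z -> Z \subset G ->
        X <*> (M :&: Z) = (X <*> M) :&: Z
    & forall Y Z, Y \subset G -> Z \subset G -> M \subset Z ->
        M <*> (Y :&: Z) = (M <*> Y) :&: Z].

Definition Hset_permutable HS H G : Prop :=
  H \subset G /\ forall A, A \in HS -> H * A = A * H.

Definition m_Hset_permutable HS H G : Prop :=
  exists A B,
    [/\ modular_subgroup A G, Hset_permutable HS B G & H :=: A <*> B].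

Definition weakly_m_Hset_permutable HS H G : Prop :=
  exists T S,
    [/\ sigma_subnormal T G, H * T = G, H :&: T \subset S, S \subset H
      & m_Hset_permutable HS S G].

End Sigma.

Section Embedding.

Variable gT : finGroupType.
Implicit Types E G K L : {group gT}.

Definition supersoluble G : Prop :=
  exists n (C : nat -> {group gT}),
    [/\ C 0%N :=: 1, C n = G
      & forall i, (i < n)%N ->
          [/\ C i \subset C i.+1, C i <| G, C i.+1 <| G
            & cyclic (C i.+1 / C i)]].

(* The upper central series of G is stationary from its #|G|-th term on: see  *)
(* hypercenter_stable.                                                        *)
Definition hypercenter (A : {set gT}) : {set gT} := 'Z_#|A|(A).

Definition hypercyclically_embedded E G : Prop :=
  E <| G /\
  (E :=: 1 \/
   (E :!=: 1 /\
    forall K L, chief_factor G K L -> L \subset E -> cyclic (L / K))).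

Lemma hypercenter_stable G n : (#|G| <= n)%N -> 'Z_n(G) = hypercenter G.
Proof.
have stepE k : 'Z_k.+1(G) = 'Z_k(G) -> 'Z_k.+2(G) = 'Z_k.+1(G).
  by move=> eqZ; rewrite [LHS]ucnSn eqZ -ucnSn.
have stab k m : 'Z_k.+1(G) = 'Z_k(G) -> 'Z_(m + k)(G) = 'Z_k(G).
  move=> eqZ.
  have stat j : 'Z_(j + k).+1(G) = 'Z_(j + k)(G).
    by elim: j => //= j IHj; rewrite addSn; apply: stepE.
  by elim: m => //= m IHm; rewrite addSn stat.
have grow k : 'Z_k.+1(G) = 'Z_k(G) \/ (k.+1 < #|'Z_k.+1(G)|)%N.
  elim: k => [|k [eqZ|ltk]]; last 2 first.
  - by left; apply: stepE.
  - case: (eqVneq 'Z_k.+2(G) 'Z_k.+1(G)) => [|neZ]; [by left | right].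
    apply: leq_ltn_trans ltk (proper_card _).
    by rewrite properEneq eq_sym neZ ucn_subS.
  case: (eqVneq 'Z_1(G) 'Z_0(G)) => [|neZ]; [by left | right].
  rewrite ltnNge -trivg_card_le1; apply: contraNneq neZ => ->.
  by rewrite ucn0.
rewrite /hypercenter => leGn; rewrite -(subnK leGn); apply: stab.
case: (grow #|G|) => // ltGZ; have := subset_leq_card (ucn_sub #|G|.+1 G).
by rewrite leqNgt (ltn_trans _ ltGZ).
Qed.

End Embedding.

(* Main.v *)
Require Import Defs.
From mathcomp Require Import all_boot all_fingroup all_solvable.
From mathcomp Require Import ssralg poly zmodp matrix mxalgebra mxpoly.
From mathcomp Require Import finfield mxrepresentation mxabelem.

(* By induction on |G| + |E| it suffices to treat a G-chief factor E / D such  *)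
(* that D contains every proper subgroup of E normal in G and all chief        *)
(* factors below D are cyclic; suppose E / D is not cyclic.                    *)
(*   If E = G, then G is perfect and insoluble, so D lies in the hypercentre.  *)
(* Let p be the least prime dividing |G|. A subgroup H of order p, or of order *)
(* 4, that is not in D can only be modular, and then it normalises every       *)
(* cyclic p'-subgroup; so do its conjugates, which generate G, whence the      *)
(* p'-elements are central and G is soluble. So these H lie in D and are       *)
(* centralised by the p'-elements; then every p'-element normalising a         *)
(* p-subgroup centralises it, and Frobenius' theorem gives a contradiction.    *)
(*   If E < G, then E is supersoluble by induction. Let p be the least prime   *)
(* dividing |E|, P a Sylow p-subgroup of E and X = N_G(P); by the Frattini     *)
(* argument P / (P /\ D) is a non-cyclic chief factor of X. Elements of the    *)
(* subgroup generated by X' and the (p - 1)-th powers centralise the chief     *)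
(* factors of X below P /\ D; this forces P to have class at most 2 and        *)
(* exponent p (or 4). A Hall subgroup of G for the block of p is supersoluble, *)
(* so it normalises some L with D < L <= E and L / D cyclic; as P /\ L is      *)
(* (P /\ D)<x> with x of order p or 4, the hypothesis on <x> makes L           *)
(* invariant under G, so L = E.                                                *)

Set Implicit Arguments.
Unset Strict Implicit.
Unset Printing Implicit Defensive.

Import GRing.Theory.

Local Open Scope group_scope.

(** The hypotheses are first reduced to statements that subgroups inherit. For a cyclic p-subgroup
    H, p in the block sigma_i, weak m-H-permutability means little
    ([weakly_m_Hset_permutable_cases]): if the supplement T is G, then H is itself modular or
    permutable, since the subgroups of a cyclic p-group form a chain; if T < G, some normal N not
    containing H has a sigma_i-group as quotient. When H is modular, or all its conjugates are
    permutable, elements of prime power order outside the block that normalise a sigma_i-subgroup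
    containing H also normalise H. The primes inside the block are dealt with by a supersoluble Hall
    subgroup. These consequences are [small_subgroups_controlled] and [supersolubly_Hall], and
    [hypercyclic_of_controlled] is the induction. Orders p and 4 suffice because a p'-element
    centralising such elements of a p-group centralises all of it ([p'elt_cent_p_or_4]), and because
    a non-cyclic top chief factor forces a small exponent ([chief_pgroup_exponent]). The case E = G,
    [controlled_full_cyclic], verifies Frobenius' condition and concludes with [Frobenius_focal].
    The case E < G, [controlled_tower_cyclic], descends to a Sylow subgroup P of E and its
    normaliser, where [chief_pgroup_cyclic] applies. *)

Definition hypercyclic (gT : finGroupType) (E G : {set gT}) : Prop :=
  forall K L : {group gT}, chief_factor G K L -> L \subset E -> cyclic (L / K).

(** * Chief factors *)

Section ChiefFactors.

Variable gT : finGroupType.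
Implicit Types D E G K L M N U V X : {group gT}.

Lemma chief_factorP G V U :
  reflect [/\ V <| G, U <| G, V \proper U &
    forall M, M <| G -> V \subset M -> M \subset U -> M :=: V \/ M :=: U]
    (chief_factor G V U).
Proof.
apply: (iffP andP) => [[/maxgroupP[/andP[ltVU nVG] maxV] nsUG] | ].
  have [sUG nUG] := andP nsUG; split=> //.
    by rewrite /normal nVG (subset_trans (proper_sub ltVU)).
  move=> M /andP[sMG nMG] sVM sMU.
  have [-> | neMU] := eqsVneq M U; first by right.
  by left; apply: maxV => //; rewrite properEneq neMU sMU nMG.
case=> /andP[sVG nVG] nsUG ltVU maxV; split=> //; apply/maxgroupP.
rewrite ltVU; split=> // M /andP[ltMU nMG] sVM.
have nsMG : M <| G.
  by rewrite /normal nMG (subset_trans (proper_sub ltMU)) ?normal_sub.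
case: (maxV M nsMG sVM (proper_sub ltMU)) => // defM.
by rewrite defM properxx in ltMU.
Qed.

Lemma hypercyclicS D E G : D \subset E -> hypercyclic E G -> hypercyclic D G.
Proof. by move=> sDE hyp K L chKL /subset_trans/(_ sDE)/hyp->. Qed.

Lemma ex_chief_factor_below E G :
  E <| G -> E :!=: 1 -> exists D : {group gT}, chief_factor G D E.
Proof.
move=> nsEG ntE; have [D maxD] : {D : {group gT} | maxnormal D E G}.
  by apply: ex_maxgroup; exists 1%G; rewrite proper1G ntE norms1.
by exists D; apply/andP.
Qed.

Lemma cyclic_quotient_supplement D E M :
  D <| E -> M \subset E -> E \subset D * M -> cyclic (M / (M :&: D)) ->
  cyclic (E / D).
Proof.
case/andP=> sDE nDE sME sEDM cycM.
have nDM := subset_trans sME nDE.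
have -> : E / D = M / D.
  apply/eqP; rewrite eqEsubset (quotientS D sME) andbT.
  by apply: subset_trans (quotientS D sEDM) _; rewrite quotientMidl.
by rewrite -(isog_cyclic (second_isog nDM)) setIC.
Qed.

(** If W is normal in X and lies between M :&: D and M, then D W is normalised by D X = G, hence is
    D or E; Dedekind's law recovers W. *)
Lemma chief_factor_supplement D E G M X :
    chief_factor G D E -> X \subset G -> G \subset D * X ->
    M <| X -> M \subset E -> E \subset D * M ->
  chief_factor X (M :&: D)%G M.
Proof.
case/chief_factorP=> nsDG nsEG ltDE minE sXG sGDX nsMX sME sEDM.
have [sDG nDG] := andP nsDG; have [sMX nMX] := andP nsMX.
have nDX := subset_trans sXG nDG.
apply/chief_factorP; split=> //.
- by rewrite /normal subIset ?sMX // normsI.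
- rewrite properE subsetIl subsetI subxx /=; apply: contra (proper_subn ltDE).
  by move=> sMD; rewrite (subset_trans sEDM) // mulG_subG subxx.
move=> W nsWX sDW sWM; have [sWX nWX] := andP nsWX.
have nDW := subset_trans sWX nDX.
have nsDW : D <*> W <| G.
  rewrite /normal join_subG sDG (subset_trans sWX) //=.
  rewrite (subset_trans sGDX) // mulG_subG (normsY nDX nWX) andbT.
  exact: subset_trans (joing_subl _ _) (normG _).
have sDWE : D <*> W \subset E.
  by rewrite join_subG proper_sub // (subset_trans sWM).
have [defD | defE] := minE _ nsDW (joing_subl _ _) sDWE; [left | right].
  apply/eqP; rewrite eqEsubset sDW subsetI sWM.
  by rewrite -defD joing_subr.
apply/eqP; rewrite eqEsubset sWM /=.
have sMDW : M \subset W * D by rewrite (normC nDW) -norm_joinEr // defE.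
have <- : W * (M :&: D) = M by rewrite setIC group_modl // (setIidPr sMDW).
by rewrite mulG_subG subxx.
Qed.

(** Otherwise E = D M, and E / D is isomorphic to the chief factor M / (M :&: D), which is
    cyclic. *)
Lemma normal_sub_chief D E G M :
    chief_factor G D E -> ~~ cyclic (E / D) -> hypercyclic M G ->
  M <| G -> M \subset E -> M \subset D.
Proof.
move=> chE ncycE hypM nsMG sME; apply: contraR ncycE => nsMD.
have /chief_factorP[nsDG nsEG ltDE minE] := chE.
have [sMG nMG] := andP nsMG; have [sDG nDG] := andP nsDG.
have nDM := subset_trans sMG nDG.
have sEDM : E \subset D * M.
  rewrite -norm_joinEr //.
  have [|defD|->] // := minE _ (normalY nsDG nsMG) (joing_subl _ _).
    by rewrite join_subG proper_sub.
  by rewrite -defD joing_subr in nsMD.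
apply: (cyclic_quotient_supplement _ sME sEDM).
  exact: normalS (proper_sub ltDE) (normal_sub nsEG) nsDG.
apply: hypM => //; apply: (chief_factor_supplement chE) => //.
exact: mulG_subr.
Qed.

(** Coprime action: fixed points of A on G / H lift to fixed points in G, so G = H 'C_G(A). *)
Lemma stable_factor_coprime_cent (A G H : {group gT}) :
    coprime #|G| #|A| -> solvable G -> H \subset G -> G \subset 'N(H) ->
    [~: G, A] \subset H -> A \subset 'C(H) ->
  A \subset 'C(G).
Proof.
move=> coGA solG sHG nHG sRH cHA.
have nHA : A \subset 'N(H) := subset_trans cHA (cent_sub H).
have cGAq : G / H \subset 'C(A / H) by rewrite quotient_cents2.
have := coprime_quotient_cent sHG nHA coGA solG.
rewrite (setIidPl cGAq) => defGH; rewrite centsC.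
have sGC : G \subset H * 'C_G(A) by rewrite -quotientSK // defGH.
by apply: subset_trans sGC _; rewrite mulG_subG subsetIr andbT centsC.
Qed.

End ChiefFactors.

Lemma hypercyclic_quotient (gT : finGroupType) (E G N : {group gT}) :
  N <| G -> E <| G -> N \subset E -> hypercyclic E G ->
  hypercyclic (E / N) (G / N).
Proof.
move=> nsNG nsEG sNE hypE K L chKL sLE.
have /chief_factorP[nsKG nsLG ltKL minL] := chKL.
have [sKG nKG] := andP nsKG; have [sLG nLG] := andP nsLG.
have sLK := proper_sub ltKL.
pose K1 := (coset N @*^-1 K)%G; pose L1 := (coset N @*^-1 L)%G.
have nsK1 : K1 <| G by rewrite -(quotientGK nsNG) cosetpre_normal.
have nsL1 : L1 <| G by rewrite -(quotientGK nsNG) cosetpre_normal.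
have chK1L1 : chief_factor G K1 L1.
  apply/chief_factorP; split=> // [|M nsMG sKM sML].
    by rewrite /proper !cosetpreSK -properE.
  have sNM : N \subset M by exact: subset_trans (sub_cosetpre K) sKM.
  have nsNM := normalS sNM (normal_sub nsMG) nsNG.
  have [||| defM | defM] := minL (M / N)%G.
  - exact: quotient_normal.
  - by rewrite -(cosetpreK K) quotientS.
  - by rewrite -(cosetpreK L) quotientS.
  - by left; rewrite /= -defM quotientGK.
  by right; rewrite /= -defM quotientGK.
have sNK1 : N \subset K1 by apply: sub_cosetpre.
have nsNL1 : N <| L1 := normal_cosetpre L.
have nsK1L1 : K1 <| L1.
  by apply: normalS (normal_sub nsL1) nsK1; rewrite cosetpreSK.
rewrite -(cosetpreK L) -(cosetpreK K) (isog_cyclic (third_isog sNK1 nsNL1 nsK1L1)).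
apply: hypE chK1L1 _; rewrite sub_cosetpre_quo //.
exact: normalS sNE (normal_sub nsEG) nsNG.
Qed.

Lemma cyclic_norm_coprime_cent (gT : finGroupType) (N R : {group gT}) :
  cyclic N -> R \subset 'N(N) -> coprime #|R| (totient #|N|) ->
  R \subset 'C(N).
Proof.
move=> cycN nNR coR; rewrite -ker_conj_aut ker_trivg_morphim nNR /=.
have coRA : coprime #|conj_aut N @* R| #|Aut N|.
  by rewrite card_Aut_cyclic // (coprime_dvdl (dvdn_morphim _ _) coR).
by rewrite -(coprime_TIg coRA) subsetI subxx Aut_conj_aut.
Qed.

(** * Sylow towers *)

Definition primes_above (p : nat) : nat_pred := [pred q | p < q].

Definition Sylow_tower (gT : finGroupType) (G : {set gT}) : Prop :=
  forall p, (primes_above p).-Hall(G) 'O_(primes_above p)(G).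

(** Let N be a minimal normal subgroup, of prime order q, and K the preimage of the Hall subgroup of
    G / N. If q > p, K is the required subgroup. If q <= p, a Schur-Zassenhaus complement R of N in
    K centralises N, since the primes dividing q - 1 are below p; so R is normal in K, hence
    characteristic in it. *)
Lemma hypercyclic_Sylow_tower (gT : finGroupType) (G : {group gT}) :
  hypercyclic G G -> Sylow_tower G.
Proof.
have [m] := ubnP #|G|; elim: m => // m IHm in gT G * => /ltnSE-leGm hypG p.
set rho := primes_above p.
suffices [H hallH nsHG] : exists2 H : {group gT}, rho.-Hall(G) H & H <| G.
  by rewrite (normal_Hall_pcore hallH).
have [-> | ntG] := eqsVneq G 1.
  by exists 1%G; rewrite ?normal1 // /pHall sub1G pgroup1 indexgg.
have [N minN sNG] := minnormal_exists ntG (normG G).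
have [/andP[ntN nNG] _] := mingroupP minN.
have nsNG : N <| G by apply/andP.
have cycN : cyclic N.
  rewrite (isog_cyclic (quotient1_isog N)) /=.
  apply: (hypG 1%G N) => //; apply/chief_factorP; split=> // [||M nsMG _ sMN].
  - exact: normal1.
  - by rewrite proper1G.
  have [-> | ntM] := eqsVneq M 1; [by left | right].
  by have [_] := mingroupP minN; apply; rewrite ?ntM ?normal_norm.
have /is_abelemP[q q_pr abelN] : is_abelem N.
  have solN : solvable N by rewrite abelian_sol ?cyclic_abelian.
  by case: (minnormal_solvable minN (subxx N) solN).
have [qN _ _] := and3P abelN.
have oN : #|N| = q := cyclic_abelem_prime abelN cycN ntN.
have hypGN : hypercyclic (G / N) (G / N) by apply: hypercyclic_quotient.
have ltGN : #|G / N| < m by apply: leq_trans leGm; apply: ltn_quotient.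
have hallKb := IHm _ _ ltGN hypGN p; rewrite -/rho in hallKb.
set Kb := 'O_rho(G / N)%G in hallKb.
pose K := (coset N @*^-1 Kb)%G.
have nsKG : K <| G by rewrite -(quotientGK nsNG) cosetpre_normal pcore_normal.
have iGK : rho^'.-nat #|G : K|.
  by rewrite -(quotientGK nsNG) index_cosetpre; case/and3P: hallKb.
have oK : #|K| = (#|N| * #|Kb|)%N by apply: card_cosetpre.
have rhoKb : rho.-group Kb by apply: pcore_pgroup.
have [rho_q | rho'q] := boolP (q \in rho).
  exists K => //; rewrite /pHall normal_sub // iGK andbT /= /pgroup oK oN pnatM.
  by rewrite pnatE // rho_q.
have rho'N : rho^'.-group N by rewrite /pgroup oN pnatE.
have nsNK : N <| K := normal_cosetpre Kb.
have hallN : Hall K N.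
  rewrite /Hall normal_sub //= -divgS ?normal_sub // oK mulKn ?cardG_gt0 //.
  by rewrite coprime_sym (pnat_coprime rhoKb).
have /splitsP[R /complP[tiNR defK]] := SchurZassenhaus_split hallN nsNK.
have oR : #|R| = #|Kb|.
  apply/eqP; rewrite -(eqn_pmul2l (cardG_gt0 N)) -oK -TI_cardMg //.
  by rewrite defK.
have rhoR : rho.-group R by rewrite /pgroup oR.
have sRK : R \subset K by rewrite -defK mulG_subr.
have cNR : R \subset 'C(N).
  apply: cyclic_norm_coprime_cent => //.
    exact: subset_trans sRK (normal_norm nsNK).
  rewrite oN totient_prime // (pnat_coprime rhoR) //.
  rewrite /pnat -subn1 subn_gt0 prime_gt1 //=; apply/allP=> r.
  rewrite mem_primes => /and3P[_ q1_gt0 /dvdn_leq-/(_ q1_gt0)]. 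
  rewrite !inE -!leqNgt in rho'q * => /leq_trans-> //.
  by rewrite (leq_trans (leq_subr _ _)).
have nsRK : R <| K.
  rewrite /normal sRK -defK mulG_subG normG andbT.
  by rewrite cents_norm // centsC.
have hallRK : rho.-Hall(K) R.
  rewrite /pHall sRK rhoR /= -divgS // oK oR mulnK ?cardG_gt0 //.
exists R.
  rewrite /pHall (subset_trans sRK) ?normal_sub // rhoR /=.
  by rewrite -(Lagrange_index (normal_sub nsKG) sRK) pnatM iGK; case/and3P: hallRK.
rewrite -(normal_Hall_pcore hallRK nsRK).
exact: char_normal_trans (pcore_char _ _) nsKG.
Qed.

(** * Irreducible actions on elementary abelian p-groups *)

(** M is a root of X^p - X, the product of all X - a with a in F_p, so some M - a is singular. *)
Lemma fermat_eigenvalue (p n : nat) (M : 'M['F_p]_n.+1) :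
  prime p -> (M ^+ p.-1 = 1)%R -> exists a : 'F_p, eigenvalue M a.
Proof.
move=> p_pr M1.
have : (horner_mx M (\prod_(x : 'F_p) ('X - x%:P)) = 0)%R.
  rewrite -finField_genPoly card_Fp // rmorphB /= rmorphXn /= horner_mx_X.
  have -> : (M ^+ p = M)%R.
    by rewrite -[X in (_ ^+ X)%R](prednK (prime_gt0 p_pr)) exprS M1 mulr1.
  exact: subrr.
rewrite rmorph_prod /= => prod0.
have : (\det (\prod_(x : 'F_p) (M - x%:M)) = 0)%R.
  rewrite -[RHS](det0 _ n) -prod0; congr (\det _)%R; apply: eq_bigr => x _.
  by rewrite rmorphB /= horner_mx_X horner_mx_C.
rewrite (big_morph _ (@det_mulmx _ _) (@det1 _ _)) => /eqP.
rewrite prodf_seq_eq0 => /hasP[a _ /= det0a]; exists a.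
by rewrite /eigenvalue kermx_eq0 row_free_unit unitmxE unitfE negbK.
Qed.

Section Scalars.

Variables (gT : finGroupType) (p : nat) (V G : {group gT}).
Hypotheses (p_pr : prime p) (abelV : p.-abelem V) (ntV : V :!=: 1).

Lemma power_eigenvector g : g \in 'N(V) -> g ^+ p.-1 \in 'C(V) ->
  exists v k, [/\ v \in V, v != 1 & v ^ g = v ^+ k].
Proof.
move=> nVg cVg.
have nVG : <[g]> \subset 'N(V) by rewrite cycle_subG.
pose rG := abelem_repr abelV ntV nVG.
have gG := cycle_id g.
have M1 : (rG g ^+ p.-1 = 1)%R.
  rewrite -(repr_mxX rG) //; apply/eqP.
  have : g ^+ p.-1 \in rker rG.
    by rewrite rker_abelem; apply/setIP; rewrite groupX.
  by case/rkerP=> _ ->.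
have [a /eigenvalueP[v /= def_va ntv]] := fermat_eigenvalue p_pr M1.
exists (rVabelem abelV ntV v), a; split.
- exact: mem_rVabelem.
- by rewrite -(rVabelem0 abelV ntV) (inj_eq (@rVabelem_inj _ _ _ abelV ntV)).
by rewrite -(rVabelemJ abelV ntV nVG) // def_va rVabelemZ.
Qed.

Hypotheses (minV : minnormal V G) (cVG' : G^`(1) \subset 'C(V)).
Hypothesis cVGp : forall g, g \in G -> g ^+ p.-1 \in 'C(V).

(** Each g in G has an eigenvector in V. Its eigenspace is invariant under G, as commutators act
    trivially, so it is V. Thus G acts by scalars, every cyclic subgroup of V is invariant, and V is
    generated by any of its non-trivial elements. *)
Lemma minnormal_scalar_cyclic : cyclic V.
Proof.
have [/andP[_ nVG] simV] := mingroupP minV; have [pV abV _] := and3P abelV.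
have scal g : g \in G -> exists k, forall v, v \in V -> v ^ g = v ^+ k.
  move=> Gg; have nVg := subsetP nVG g Gg.
  have [v [k [Vv ntv def_vg]]] := power_eigenvector nVg (cVGp Gg).
  pose W := [set w in V | w ^ g == w ^+ k].
  have gW : group_set W.
    apply/group_setP; split; first by rewrite inE group1 conj1g expg1n /=.
    move=> x y; rewrite !inE => /andP[Vx /eqP xg] /andP[Vy /eqP yg].
    by rewrite groupM //= conjMg xg yg expgMn //; apply: (centsP abV).
  have defW : W = V.
    apply: (simV (group gW)); last by apply/subsetP=> w; rewrite inE => /andP[].
    apply/andP; split.
      apply: contraNneq ntv => /= W1; have : v \in W by rewrite inE Vv def_vg /=.
      by rewrite W1 => /set1P->.
    apply/normsP=> h Gh /=; apply/eqP; rewrite eqEcard cardJg leqnn andbT.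
    apply/subsetP=> _ /imsetP[w + ->]; rewrite !inE => /andP[Vw /eqP wg].
    have nVh := subsetP nVG h Gh; rewrite memJ_norm // Vw /=.
    have -> : (w ^ h) ^ g = ((w ^ g) ^ h) ^ [~ h, g].
      by rewrite -!conjgM mulgA -commgC.
    have Vwgh : (w ^ g) ^ h \in V by rewrite !memJ_norm.
    have cR : [~ h, g] \in 'C(V) by rewrite (subsetP cVG') // mem_commg.
    by rewrite [_ ^ [~ h, g]]conjgE -(centP cR) // mulKg wg conjXg.
  by exists k => w; rewrite -defW inE => /andP[_ /eqP].
have [v Vv ntv] := trivgPn _ ntV.
suff <- : <[v]> = V by apply: cycle_cyclic.
apply: (simV <[v]>%G); last by rewrite cycle_subG.
rewrite cycle_eq1 ntv; apply/normsP=> g /scal[k scal_g].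
by apply/eqP; rewrite eqEcard cardJg leqnn andbT -cycleJ cycle_subG scal_g // mem_cycle.
Qed.

End Scalars.

(** * The subgroup acting trivially on cyclic chief p-factors, and O^p *)

Section FermatCore.

Variables (gT : finGroupType) (p : nat).
Implicit Types G N X D K L : {group gT}.

(* Acts trivially on every section of order p, as Aut(C_p) is abelian of       *)
(* exponent p - 1.                                                            *)
Definition fermat_core (G : {set gT}) : {set gT} :=
  G^`(1) <*> [set g ^+ p.-1 | g in G].

Canonical fermat_core_group (G : {set gT}) := [group of fermat_core G].

Lemma fermat_core_normal G : fermat_core G <| G.
Proof.
apply: sub_der1_normal; first exact: joing_subl.
rewrite join_subG der_sub; apply/subsetP=> _ /imsetP[g Gg ->].
exact: groupX.
Qed.

Lemma fermat_core_power G g : g \in G -> g ^+ p.-1 \in fermat_core G.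
Proof.
move=> Gg; apply: subsetP (joing_subr _ _) _ _.
by apply: imset_f.
Qed.

End FermatCore.

Lemma der1_cent_cyclic (gT : finGroupType) (N G : {group gT}) :
  cyclic N -> G \subset 'N(N) -> G^`(1) \subset 'C(N).
Proof.
move=> cycN nNG; rewrite -ker_conj_aut ker_trivg_morphim.
rewrite (subset_trans (der_sub 1 G)) //= morphim_der //; apply/trivgP/derG1P.
exact: abelianS (Aut_conj_aut _ _) (Aut_cyclic_abelian cycN).
Qed.

Lemma fermat_power_cent (gT : finGroupType) (N : {group gT}) g :
  prime #|N| -> g \in 'N(N) -> g ^+ #|N|.-1 \in 'C(N).
Proof.
move=> N_pr nNg; rewrite -ker_conj_aut; apply/kerP; first exact: groupX.
rewrite morphX // -totient_prime // -card_Aut_cyclic ?prime_cyclic //.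
by rewrite expg_cardG // Aut_aut.
Qed.

(** The chief factors of G below D have order p, so a acts trivially on each; as a p'-element
    stabilising this series, it centralises D. *)
Lemma fermat_core_hypercyclic_cent (gT : finGroupType) (p : nat) (D G : {group gT}) a :
    p.-group D -> D <| G -> hypercyclic D G ->
    a \in fermat_core p G -> p^'.-elt a ->
  a \in 'C(D).
Proof.
have [m] := ubnP #|D|; elim: m D => // m IHm D /ltnSE-leDm pD nsDG hypD Wa p'a.
have [-> | ntD] := eqsVneq D 1; first by rewrite cent1T inE.
have [K chK] := ex_chief_factor_below nsDG ntD.
have /chief_factorP[nsKG _ ltKD minD] := chK.
have sKD := proper_sub ltKD; have [sKG nKG] := andP nsKG.
have cKa : a \in 'C(K).
  apply: IHm => //; first exact: leq_trans (proper_card ltKD) leDm.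
    exact: pgroupS pD.
  exact: hypercyclicS hypD.
have cycDK := hypD _ _ chK (subxx D).
have oDK : prime #|D / K|.
  have [_ ntDK /is_abelemP[q q_pr abelDK]] :=
    minnormal_solvable (chief_factor_minnormal chK) (subxx _) (quotient_sol K (pgroup_sol pD)).
  by rewrite (cyclic_abelem_prime abelDK).
have oDKp : #|D / K| = p.
  have : p.-group (D / K) by apply: quotient_pgroup.
  by rewrite /pgroup pnatE // => /eqP.
have nDKG : G / K \subset 'N(D / K) by rewrite quotient_norms ?normal_norm.
have cWDK : fermat_core p G / K \subset 'C(D / K).
  rewrite sub_quotient_pre; last exact: subset_trans (normal_sub (fermat_core_normal p G)) nKG.
  rewrite /fermat_core join_subG -sub_quotient_pre ?(subset_trans (der_sub 1 G)) //.
  rewrite quotient_der // der1_cent_cyclic //=.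
  apply/subsetP=> _ /imsetP[g Gg ->]; have nKg := subsetP nKG g Gg.
  rewrite mem_morphpre ?groupX //= morphX // -oDKp fermat_power_cent //.
  by rewrite (subsetP nDKG) ?mem_quotient.
have nKa : a \in 'N(K) := subsetP (cent_sub K) a cKa.
rewrite -cycle_subG; apply: (@stable_factor_coprime_cent _ _ _ K) => //.
- exact: pnat_coprime pD p'a.
- exact: pgroup_sol pD.
- exact: subset_trans (normal_sub nsDG) nKG.
- rewrite -quotient_cents2 ?cycle_subG //; last exact: subset_trans (normal_sub nsDG) nKG.
  rewrite centsC quotient_cycle // cycle_subG.
  by apply: (subsetP cWDK); apply: mem_quotient.
by rewrite cycle_subG.
Qed.

Section PResidual.

Variables (gT : finGroupType) (p : nat).
Implicit Types W G : {group gT}.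

(* The subgroup usually written O^p(W). *)
Definition p_residual (W : {set gT}) : {set gT} := <<[set a in W | p^'.-elt a]>>.

Canonical p_residual_group (W : {set gT}) := [group of p_residual W].

Lemma p_residual_sub W : p_residual W \subset W.
Proof. by rewrite gen_subG; apply/subsetP=> a /setIdP[]. Qed.

Lemma p_residual_normal W G : W <| G -> p_residual W <| G.
Proof.
case/andP=> sWG nWG; rewrite /normal (subset_trans (p_residual_sub W)) //=.
rewrite norms_gen //; apply/normsP=> g Gg; apply/setP=> a.
by rewrite mem_conjg !inE p_eltJ memJ_norm // groupV (subsetP nWG).
Qed.

(** For every prime q other than p, the subgroup contains the Sylow q-subgroups of W. *)
Lemma p_residual_index W : p.-nat #|W : p_residual W|.
Proof.
apply/pnatP=> // q q_pr q_dvd; rewrite inE; apply: contraLR q_dvd => neqqp.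
have [Q sylQ] := Sylow_exists q W; have [sQW qQ q'WQ] := and3P sylQ.
have sQO : Q \subset p_residual W.
  apply/subsetP=> a Qa; rewrite mem_gen // inE (subsetP sQW) //.
  by apply: sub_p_elt (mem_p_elt qQ Qa) => r; rewrite !inE => /eqP->.
rewrite -p'natE //; apply: pnat_dvd q'WQ.
by rewrite -(Lagrange_index (p_residual_sub W) sQO) dvdn_mulr.
Qed.

End PResidual.

(** * Transfer and Frobenius' normal complement theorem *)

Lemma p_residual_mul_Sylow (gT : finGroupType) (p : nat) (W S : {group gT}) :
  p.-Sylow(W) S -> p_residual p W * S = W.
Proof.
move=> sylS; have [sSW pS p'WS] := and3P sylS.
have sRW := p_residual_sub p W.
have nsRW : p_residual p W <| W := p_residual_normal p (normal_refl W).
have sRSW : p_residual p W <*> S \subset W by rewrite join_subG sRW.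
rewrite -norm_joinEr ?(subset_trans sSW) ?normal_norm //.
apply/eqP; rewrite eqEsubset sRSW /= -indexg_eq1; apply/eqP/(@pnat_1 p).
  apply: pnat_dvd (p_residual_index p W).
  by rewrite -(Lagrange_index sRSW (joing_subl _ S)) dvdn_mulr.
apply: pnat_dvd p'WS.
by rewrite -(Lagrange_index sRSW (joing_subr _ S)) dvdn_mulr.
Qed.

(** Under this fusion condition the transfer to P / P' sends x in P to the class of x ^+ #|G : P|.
    It kills G', and #|G : P| is prime to p. *)
Lemma focal_Sylow (gT : finGroupType) (p : nat) (G P : {group gT}) :
    p.-Sylow(G) P ->
    (forall x g, x \in P -> g \in G -> x ^ g \in P ->
       exists2 u, u \in P & x ^ g = x ^ u) ->
  P :&: G^`(1) \subset P^`(1).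
Proof.
move=> sylP fusionP; have [sPG pP p'iGP] := and3P sylP.
apply/subsetP=> x /setIP[Px G1x].
have nP'P : P \subset 'N(P^`(1)) := der_norm 1 P.
pose alpha := restrm_morphism nP'P (coset_morphism P^`(1)).
have abP : abelian (alpha @* P) by rewrite morphim_restrm setIid der_abelian.
have Gx := subsetP sPG x Px.
have tr1 : transfer G abP x = 0%R.
  have /trivgP : transfer_morphism G abP @* G^`(1) = 1.
    by rewrite morphim_der //; apply/derG1P/centsP=> u _ v _; apply: GRing.addrC.
  by move/subsetP=> /(_ _ (mem_morphim _ Gx G1x)) /set1P.
pose X := transversal (rcosets P G :* <[x]>) G.
have trX : is_transversal X (rcosets P G :* <[x]>) G.
  exact/transversalP/rcosets_cycle_partition.
(* The transfer is a sum of classes of elements (x ^+ n) ^ y^-1 of P. By the fusion hypothesis each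
   has the class of x ^+ n, and the exponents n add up to #|G : P|. *)
rewrite (transfer_cycle_expansion sPG abP Gx trX) in tr1.
pose k := #|G : P|; pose xm := FiniteModule.fmod abP (coset P^`(1) x).
have {tr1} : (xm *+ k = 0)%R.
  rewrite /k -(sum_index_rcosets_cycle sPG Gx trX) -GRing.sumrMnr -[RHS]tr1.
  apply: eq_bigr => y Xy.
  have Gy : y \in G by apply: subsetP Xy; apply: transversal_sub trX.
  set n := #|_ : _|; have Pxn : (x ^+ n) ^ y^-1 \in P.
    by rewrite conjgE invgK mulgA -mem_rcoset mulg_exp_card_rcosets.
  have [|||u Pu ->] := fusionP (x ^+ n) y^-1; rewrite ?groupX ?groupV //.
  rewrite /restrm /= morphJ ?(subsetP nP'P) ?groupX //.
  have abQ : abelian (P / P^`(1)) := der_abelian 0 P.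
  have Qxn := mem_quotient P^`(1) (groupX n Px).
  rewrite conjgE (centsP abQ _ Qxn _ (mem_quotient _ Pu)) mulKg.
  rewrite morphX ?(subsetP nP'P) // -FiniteModule.fmodX //.
  exact: (mem_morphim alpha).
have Qx : coset P^`(1) x \in P / P^`(1) by apply: mem_quotient.
move/(congr1 val); rewrite FiniteModule.fmvalZ /xm FiniteModule.fmodK => [xk1|].
  have co_k : coprime #|P / P^`(1)| k.
    by apply: pnat_coprime p'iGP; apply: quotient_pgroup.
  apply: coset_idr; first exact: (subsetP nP'P).
  by rewrite -(expgK co_k Qx) xk1 expg1n.
exact: (mem_morphim alpha).
Qed.

Section Frobenius.

Variables (gT : finGroupType) (p : nat) (G : {group gT}).
Implicit Types P Q S U : {group gT}.

(* Frobenius' condition: each N_G(U) / C_G(U) is a p-group. *)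
Hypothesis local_cent : forall U a, U \subset G -> p.-group U ->
  a \in 'N_G(U) -> p^'.-elt a -> a \in 'C(U).

Lemma p_residual_local_cent U :
  U \subset G -> p.-group U -> p_residual p 'N_G(U) \subset 'C(U).
Proof.
move=> sUG pU; rewrite gen_subG; apply/subsetP=> a; rewrite inE => /andP[].
exact: local_cent.
Qed.

(** Downward induction on the order of U = P :&: Q. Normalisers grow in p-groups, so in the chain P,
    P1, P1 :^ c, P2, Q each consecutive pair, apart from the one conjugated by c in 'C(U), meets in
    more than U. *)
Lemma Sylow_conj_centI P Q :
  p.-Sylow(G) P -> p.-Sylow(G) Q ->
  exists2 g, g \in 'C_G(P :&: Q) & Q :=: P :^ g.
Proof.
have [m] := ubnP (#|G| - #|P :&: Q|); elim: m P Q => // m IHm P Q lePQm sylP sylQ.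
pose U := (P :&: Q)%G.
have [sPG pP _] := and3P sylP; have [sQG pQ _] := and3P sylQ.
have sUG : U \subset G by rewrite subIset ?sPG.
have pU : p.-group U := pgroupS (subsetIl _ _) pP.
have IH P1 P2 : U \proper P1 :&: P2 -> p.-Sylow(G) P1 -> p.-Sylow(G) P2 ->
    exists2 g, g \in 'C_G(U) & P2 :=: P1 :^ g.
  move=> ltU sylP1 sylP2; have [|g] := IHm P1 P2 _ sylP1 sylP2.
    rewrite -ltnS; apply: leq_trans lePQm; rewrite ltnS.
    have ltUP12 := proper_card ltU; apply: ltn_sub2l => //.
    apply: leq_trans ltUP12 _.
    by rewrite subset_leq_card // subIset ?(pHall_sub sylP1).
  case/setIP=> Gg cg ->; exists g => //.
  by rewrite inE Gg (subsetP (centS (proper_sub ltU))).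
have [eqPQ | neqPQ] := eqsVneq P Q.
  by exists 1; rewrite ?group1 // conjsg1 eqPQ.
have oPQ : #|P| = #|Q| by rewrite (card_Hall sylP) (card_Hall sylQ).
have ltUP : U \proper P.
  rewrite properEneq subsetIl andbT; apply: contra neqPQ => /eqP/setIidPl sPQ.
  by rewrite eqEcard sPQ oPQ /=.
have ltUQ : U \proper Q.
  rewrite properEneq subsetIr andbT; apply: contra neqPQ => /eqP/setIidPr sPQ.
  by rewrite eq_sym eqEcard sPQ oPQ /=.
have ltNP := nilpotent_proper_norm (pgroup_nil pP) ltUP.
have ltNQ := nilpotent_proper_norm (pgroup_nil pQ) ltUQ.
have sNPN : 'N_P(U) \subset 'N_G(U) := setSI _ sPG.
have sNQN : 'N_Q(U) \subset 'N_G(U) := setSI _ sQG.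
have [S1 sylS1 sPS1] := Sylow_superset sNPN (pgroupS (subsetIl _ _) pP).
have [S2 sylS2 sQS2] := Sylow_superset sNQN (pgroupS (subsetIl _ _) pQ).
have sNG := subsetIl G 'N(U).
have [P1 sylP1 sSP1] :=
  Sylow_superset (subset_trans (pHall_sub sylS1) sNG) (pHall_pgroup sylS1).
have [P2 sylP2 sSP2] :=
  Sylow_superset (subset_trans (pHall_sub sylS2) sNG) (pHall_pgroup sylS2).
have [y Ny defS2y] := Sylow_trans sylS1 sylS2.
(* The factor of y lying in S1 does not move S1, so the conjugating element may be taken in
   O^p('N_G(U)), which centralises U. *)
have /mulsgP[c' s Rc' Ss defy] : y^-1 \in p_residual p 'N_G(U) * S1.
  by rewrite p_residual_mul_Sylow ?groupV.
pose c := c'^-1; have Cc : c \in 'C_G(U).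
  rewrite groupV inE (subsetP (p_residual_local_cent sUG pU)) // andbT.
  exact: subsetP sNG _ (subsetP (p_residual_sub p 'N_G(U)) c' Rc').
have defS2 : S2 :=: S1 :^ c.
  by rewrite defS2y -[y]invgK defy invMg conjsgM (conjGid (groupVr Ss)).
have [Gc _] := setIP Cc.
have [||| a Ca defP1] := IH P P1 => //.
  by apply: proper_sub_trans ltNP _; rewrite subsetI subsetIl (subset_trans sPS1).
have [||| b Cb defP2] := IH (P1 :^ c)%G P2 => //.
  apply: proper_sub_trans ltNQ _; apply: subset_trans sQS2 _.
  by rewrite subsetI sSP2 defS2 conjSg sSP1.
  by rewrite pHallJ.
have [||| d Cd defQ] := IH P2 Q => //.
  by apply: proper_sub_trans ltNQ _; rewrite subsetI subsetIl (subset_trans sQS2).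
exists (a * c * b * d); first by rewrite !groupM.
by rewrite defQ defP2 /= defP1 !conjsgM.
Qed.

(** P :^ g and P share x ^ g, so an element c fixing x ^ g moves P :^ g back to P. Then g c
    normalises P, and modulo elements centralising P it lies in P. *)
Lemma Sylow_controls_fusion P x g :
    p.-Sylow(G) P -> x \in P -> g \in G -> x ^ g \in P ->
  exists2 u, u \in P & x ^ g = x ^ u.
Proof.
move=> sylP Px Gg Pxg; have [sPG pP _] := and3P sylP.
have sylPg : p.-Sylow(G) (P :^ g)%G by rewrite pHallJ.
have [c /setIP[Gc cPc] defP] := Sylow_conj_centI sylPg sylP.
have eq_xgc : x ^ g = x ^ (g * c).
  rewrite conjgM [RHS]conjgE -(centP cPc) ?mulKg // inE Pxg.
  by rewrite memJ_conjg Px.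
have Ngc : g * c \in 'N_G(P) by rewrite inE groupM //= inE conjsgM -defP.
have sylPN : p.-Sylow('N_G(P)) P.
  by apply: pHall_subl sylP; rewrite ?subsetI ?sPG ?normG ?subsetIl.
have /mulsgP[o u Oo Pu defgc] : g * c \in p_residual p 'N_G(P) * P.
  by rewrite p_residual_mul_Sylow.
exists u => //; rewrite eq_xgc defgc conjgM; congr (_ ^ u).
by rewrite conjgE -(centP (subsetP (p_residual_local_cent sPG pP) o Oo)) ?mulKg.
Qed.

Lemma Frobenius_focal P : p.-Sylow(G) P -> P :&: G^`(1) \subset P^`(1).
Proof.
by move=> sylP; apply: focal_Sylow (sylP) _ => x g; apply: Sylow_controls_fusion.
Qed.

End Frobenius.

Lemma p'der1_pcore_Hall (gT : finGroupType) (p : nat) (G : {group gT}) :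
  p^'.-group G^`(1) -> p^'.-Hall(G) 'O_p^'(G).
Proof.
move=> p'G'; have nilQ : nilpotent (G / G^`(1)).
  by rewrite abelian_nil ?der_abelian.
have := nilpotent_pcore_Hall p^' nilQ.
rewrite (pquotient_pcore (der_normal 1 G) p'G') pquotient_pHall ?der_normal //.
rewrite /normal pcore_max ?der_normal //.
exact: subset_trans (pcore_sub _ _) (der_norm 1 G).
Qed.

(** If U is non-trivial, Aut(U) has order (p - 1) p^m, which is prime to the order of a: the primes
    dividing #[a] are not below p and differ from p. *)
Lemma min_prime_cyclic_cent (gT : finGroupType) (p : nat) (U : {group gT}) a :
    prime p -> p.-group U -> cyclic U -> a \in 'N(U) -> p^'.-elt a ->
    (forall q, prime q -> q %| #[a] -> p <= q) ->
  a \in 'C(U).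
Proof.
move=> p_pr pU cycU nUa p'a minp; rewrite -cycle_subG.
have [U1 | ntU] := eqsVneq U 1; first by rewrite U1 cents1.
apply: cyclic_norm_coprime_cent; rewrite ?cycle_subG //.
have [_ _ [m oU]] := pgroup_pdiv pU ntU.
rewrite oU totient_pfactor //= coprimeMr coprimeXr ?andbT; last first.
  by rewrite coprime_sym prime_coprime // -p'natE.
rewrite coprime_sym; apply: (@pnat_coprime [pred q | q < p]).
  apply/pnatP; first by rewrite -subn1 subn_gt0 prime_gt1.
  move=> q q_pr q_dvd; rewrite inE (leq_ltn_trans (dvdn_leq _ q_dvd)) //.
    by rewrite -subn1 subn_gt0 prime_gt1.
  by rewrite prednK ?prime_gt0.
by apply/pnatP=> // q q_pr q_dvd; rewrite !inE -leqNgt minp.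
Qed.

(** All p-subgroups are cyclic, so Frobenius' condition holds and P :&: G' lies in P' = 1; hence G'
    is a p'-group. *)
Lemma Burnside_min_prime (gT : finGroupType) (p : nat) (G P : {group gT}) :
    prime p -> p.-Sylow(G) P -> cyclic P ->
    (forall q, q \in \pi(G) -> p <= q) ->
  p^'.-Hall(G) 'O_p^'(G).
Proof.
move=> p_pr sylP cycP minp; apply: p'der1_pcore_Hall.
have [sPG pP p'iGP] := and3P sylP.
have tiPG' : P :&: G^`(1) = 1.
  apply/trivgP; rewrite -(derG1P (cyclic_abelian cycP)).
  apply: Frobenius_focal (sylP) => U a sUG pU /setIP[Ga nUa] p'a.
  apply: (min_prime_cyclic_cent p_pr pU) => // [|q q_pr q_dvd].
    have [x _ sUPx] := Sylow_subJ sylP sUG pU.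
    by rewrite (cyclicS sUPx) ?cyclicJ.
  by rewrite minp // mem_primes q_pr cardG_gt0 (dvdn_trans q_dvd) ?order_dvdG.
have := card_Hall (Hall_setI_normal (der_normal 1 G) sylP).
rewrite /= tiPG' cards1 => /esym/eqP; rewrite p_part_eq1.
by rewrite /pgroup p'natEpi ?cardG_gt0.
Qed.

(** * Chief factors that are p-groups *)

(* The exponent is chosen so that p divides 'C(p_or_4, 2) unless U is abelian, *)
(* which makes x |-> x ^+ p_or_4 a morphism in class 2.                       *)
Definition p_or_4 (gT : finGroupType) (p : nat) (U : {set gT}) : nat :=
  if (p == 2) && ~~ abelian U then 4 else p.

Section Power.

Variables (gT : finGroupType) (p : nat).
Implicit Types U V : {group gT}.
Hypothesis p_pr : prime p.

Lemma p_or_4S U V : V \subset U -> p_or_4 p V %| p_or_4 p U.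
Proof.
move=> sVU; rewrite /p_or_4; case: eqP => //= -> .
case: ifP => [nabV | _]; last by case: ifP.
by rewrite (contra (abelianS sVU) nabV).
Qed.

Lemma dvdn_p_or_4 U : p %| p_or_4 p U.
Proof. by rewrite /p_or_4; case: ifP => // /andP[/eqP-> _]. Qed.

Lemma order_p_or_4 U (x : gT) :
    x ^+ p_or_4 p U = 1 -> x != 1 ->
  #[x] = p \/ [/\ p = 2, #[x] = 4 & ~~ abelian U].
Proof.
rewrite -order_eq1 /p_or_4; case: ifP => [/andP[/eqP p2 nabU] | _] xn ntx.
  have : #[x] %| 2 ^ 2 by rewrite order_dvdn xn.
  case/(dvdn_pfactor _ _ (isT : prime 2)) => [[|[|[|//]]]] _ ox; rewrite ox // in ntx *.
    by left; rewrite p2.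
  by right; rewrite p2.
have : #[x] %| p by rewrite order_dvdn xn.
by move/(prime_nt_dvdP p_pr ntx); left.
Qed.

(** In class 2, (y z)^n = y^n z^n [z, y]^'C(n, 2). The commutator has p-th power 1 because z^p is
    central, and p divides 'C(n, 2) unless U is abelian. *)
Lemma expgM_p_or_4 U :
    (forall x, x \in U -> x ^+ p \in 'C(U)) -> U^`(1) \subset 'C(U) ->
  {in U &, {morph (fun y => y ^+ p_or_4 p U) : y z / y * z}}.
Proof.
move=> cUp cUU' y z Uy Uz.
have cR := centP (subsetP cUU' _ (mem_commg Uz Uy)).
rewrite expMg_Rmul; try by apply/commute_sym/cR.
suff -> : [~ z, y] ^+ 'C(p_or_4 p U, 2) = 1 by rewrite mulg1.
have Rp : [~ z, y] ^+ p = 1.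
  rewrite -commXg; last by apply/commute_sym/cR.
  by apply/eqP/commgP; apply: (centP (cUp z Uz)).
rewrite /p_or_4; case: ifP => [/andP[/eqP p2 _] | ].
  (* Here n = 4 and 'C(4, 2) = 2 * 3. *)
  by rewrite (expgM _ 2 3) -[X in _ ^+ X ^+ _]p2 Rp expg1n.
move/negbT; rewrite negb_and negbK => /orP[neq2 | abU].
  have /dvdnP[k ->] : p %| 'C(p, 2).
    by apply: prime_dvd_bin; rewrite //= ltn_neqAle [2 == _]eq_sym neq2 prime_gt1.
  by rewrite mulnC expgM Rp expg1n.
by rewrite (eqP (introT commgP (centsP abU z Uz y Uy))) expg1n.
Qed.

(** By induction a centralises the proper a-invariant subgroups, so one may assume [U, a] = U. The
    three subgroup lemma then makes 'Phi(U) central, and x |-> x ^+ n, n = [p_or_4 p U], is a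
    morphism into 'Phi(U), which a centralises. Hence c = [x, a] satisfies c ^+ n = 1 and is fixed
    by a, so x ^ (a ^+ k) = x c ^+ k; taking k = #[a] gives c = 1. *)
Lemma p'elt_cent_p_or_4 U a :
    p.-group U -> a \in 'N(U) -> p^'.-elt a ->
    (forall x, x \in U -> x ^+ p_or_4 p U = 1 -> a \in 'C[x]) ->
  a \in 'C(U).
Proof.
have [m] := ubnP #|U|; elim: m U => // m IHm U /ltnSE-leUm pU nUa p'a fixU.
have [-> | ntU] := eqsVneq U 1; first by rewrite cent1T inE.
have coUa : coprime #|U| #[a] := pnat_coprime pU p'a.
have solU := pgroup_sol pU.
have IH V : V \proper U -> a \in 'N(V) -> a \in 'C(V).
  move=> ltVU nVa; apply: IHm => // [||x Vx xn].
  - exact: leq_trans (proper_card ltVU) leUm.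
  - exact: pgroupS (proper_sub ltVU) pU.
  apply: fixU; first exact: subsetP (proper_sub ltVU) x Vx.
  by have /dvdnP[k ->] := p_or_4S (proper_sub ltVU); rewrite mulnC expgM xn expg1n.
have nUA : <[a]> \subset 'N(U) by rewrite cycle_subG.
have sRU : [~: U, <[a]>] \subset U by rewrite commg_subl.
have [defR | neRU] := eqVneq [~: U, <[a]>] U; last first.
  have cRa : a \in 'C([~: U, <[a]>]).
    apply: (IH [~: U, <[a]>]%G); first by rewrite properEneq neRU.
    by rewrite -cycle_subG commg_normr.
  rewrite -cycle_subG; apply: (stable_factor_coprime_cent coUa solU sRU) => //.
    exact: commg_norml.
  by rewrite cycle_subG.
have cKa : a \in 'C('Phi(U)).
  apply: IH; first exact: Phi_proper.
  by rewrite -cycle_subG (char_norm_trans (Phi_char U)).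
have cUK : 'Phi(U) \subset 'C(U).
  have cAK : [~: <[a]>, 'Phi(U)] = 1 by apply/commG1P; rewrite cycle_subG.
  rewrite centsC; apply/commG1P; rewrite -{1}defR.
  apply: (three_subgroup (H := 'Phi(U)%G)); first by rewrite cAK comm1G.
  apply/trivgP; rewrite -cAK (commGC <[a]>) commSg // commg_subl.
  exact: normal_norm (Phi_normal U).
have defK := Phi_joing pU.
have sU'K : U^`(1) \subset 'Phi(U) by rewrite defK joing_subl.
have KUp x : x \in U -> x ^+ p \in 'Phi(U).
  move=> Ux; rewrite defK; apply: subsetP (joing_subr _ _) _ _.
  by rewrite -[p in x ^+ p]expn1 Mho_p_elt // (mem_p_elt pU).
have cUp x Ux := subsetP cUK _ (KUp x Ux).
have KUn x : x \in U -> x ^+ p_or_4 p U \in 'Phi(U).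
  by move=> Ux; have /dvdnP[k ->] := dvdn_p_or_4 U; rewrite mulnC expgM groupX ?KUp.
have XnM := expgM_p_or_4 cUp (subset_trans sU'K cUK).
apply/centP=> x Ux; apply/commgP/eqP.
suff : [~ x, a] = 1 by rewrite -invg_comm => ->; rewrite invg1.
set c := [~ x, a]; have Uxa : x ^ a \in U by rewrite memJ_norm.
have Uc : c \in U by rewrite /c commgEl groupM ?groupV.
have fixc : a \in 'C[c].
  apply: fixU => //.
  have : (x ^ a) ^+ p_or_4 p U = x ^+ p_or_4 p U.
    rewrite -conjXg; apply/conjg_fixP/commgP/commute_sym.
    by apply: (centP cKa); apply: KUn.
  rewrite conjg_mulR XnM // => /(canRL (mulKg _)) ->.
  by rewrite mulVg.
have xak k : x ^ (a ^+ k) = x * c ^+ k.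
  elim: k => [|k IHk]; first by rewrite conjg1 mulg1.
  rewrite expgSr conjgM IHk conjMg conjg_mulR -/c conjXg -mulgA; congr (_ * _).
  by rewrite [c ^ a]conjgE -(cent1P fixc) mulKg -expgS.
have ck : c ^+ #[a] = 1.
  by apply: (mulgI x); rewrite -xak expg_order conjg1 mulg1.
by rewrite -(expgK coUa Uc) ck expg1n.
Qed.

End Power.

Section ChiefPGroup.

Variables (gT : finGroupType) (p : nat) (D P G : {group gT}).
Hypotheses (p_pr : prime p) (pP : p.-group P) (chP : chief_factor G D P).

Let W := fermat_core_group p G.
Let O := p_residual_group p W.

(** W then acts on P / D through its Sylow p-subgroup S, so it has non-trivial fixed points there;
    they form a G-invariant subgroup, hence all of P / D. So [minnormal_scalar_cyclic] applies. *)
Lemma chief_cyclic_of_stable : [~: P, O] \subset D -> cyclic (P / D).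
Proof.
have /chief_factorP[nsDG nsPG ltDP minP] := chP.
have [sPG nPG] := andP nsPG; have [sDG nDG] := andP nsDG.
have minV := chief_factor_minnormal chP.
have solV : solvable (P / D) := quotient_sol D (pgroup_sol pP).
have [nVG ntV abV] := minnormal_solvable minV (subxx _) solV.
have pV : p.-group (P / D) := quotient_pgroup D pP.
have {abV} abelV : p.-abelem (P / D).
  by rewrite -is_abelem_pgroup.
move=> sPOD.
have sWG : W \subset G := normal_sub (fermat_core_normal p G).
have sOW : O \subset W := p_residual_sub p W.
have nDO := subset_trans (subset_trans sOW sWG) nDG.
have cOV : O / D \subset 'C(P / D).
  by rewrite centsC quotient_cents2 // (subset_trans sPG).
have [S sylS] := Sylow_exists p W; have [sSW pS _] := and3P sylS.
have nDS := subset_trans (subset_trans sSW sWG) nDG.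
have defW : O <*> S = W.
  rewrite norm_joinEr ?(p_residual_mul_Sylow sylS) // (subset_trans sSW) //.
  exact: normal_norm (p_residual_normal p (normal_refl W)).
have nSV : S / D \subset 'N(P / D).
  by apply: subset_trans nVG; rewrite quotientS // (subset_trans sSW).
have cWV : W / D \subset 'C(P / D).
  have minC : 'C_(P / D)(W / D) = P / D.
    have [_ simV] := mingroupP minV.
    apply: (simV 'C_(P / D)(W / D)%G); last exact: subsetIl.
    rewrite normsI ?norms_cent ?quotient_norms ?normal_norm ?fermat_core_normal //.
    rewrite andbT.
    have pVS : p.-group ((P / D) <*> (S / D)).
      by rewrite norm_joinEr // pgroupM pV quotient_pgroup.
    have nsV : P / D <| (P / D) <*> (S / D) by rewrite normalYl.
    apply: subG1_contra (meet_center_nil (pgroup_nil pVS) nsV ntV).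
    rewrite subsetI subsetIl /= -[in 'C(_)]defW quotientY // centY subsetI.
    apply/andP; split; first by apply: subset_trans (subsetIl _ _) _; rewrite centsC.
    apply: subset_trans (subsetIr _ _) (subset_trans (subsetIr _ _) _).
    by rewrite centS ?joing_subr.
  by rewrite centsC -minC subsetIr.
apply: (minnormal_scalar_cyclic p_pr abelV ntV minV).
  apply: subset_trans cWV; rewrite -quotient_der // quotientS //.
  exact: joing_subl.
move=> _ /morphimP[g nDg Gg ->]; rewrite -morphX //.
by apply: (subsetP cWV); apply: mem_quotient; apply: fermat_core_power.
Qed.

Hypotheses (hypD : hypercyclic D G) (ncycPD : ~~ cyclic (P / D)).
Hypothesis maxD : forall M : {group gT},
  M <| G -> M \subset P -> M :!=: P -> M \subset D.

(** O is generated by such elements a; if all of them acted trivially on P / D, so would O, and P /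
    D would be cyclic. *)
Lemma ex_unstable_p'elt :
  exists a x, [/\ a \in W, p^'.-elt a, x \in P & [~ x, a] \notin D].
Proof.
have /chief_factorP[nsDG nsPG _ _] := chP; have [sDG nDG] := andP nsDG.
pose good a := [exists x in P, [~ x, a] \notin D].
have [/exists_inP[a /andP[Wa p'a] /exists_inP[x Px nDxa]] | ] :=
  boolP [exists (a | (a \in W) && p^'.-elt a), good a]; first by exists a, x.
rewrite negb_exists_in => /forall_inP allD; case/negP: ncycPD.
apply: chief_cyclic_of_stable.
have sOG : O \subset G.
  exact: subset_trans (p_residual_sub p W) (normal_sub (fermat_core_normal p G)).
have nDO := subset_trans sOG nDG.
have nDP := subset_trans (normal_sub nsPG) nDG.
rewrite -quotient_cents2 // centsC sub_quotient_pre //= gen_subG.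
apply/subsetP=> a /[dup]/mem_gen Oa; rewrite inE => Wa.
have nDa := subsetP nDO a Oa.
rewrite mem_morphpre //; apply/centP=> _ /morphimP[x nDx Px ->].
apply/commute_sym/commgP/eqP; rewrite -morphR //; apply: coset_id.
by apply: contraR (allD a Wa) => nDxa; apply/exists_inP; exists x.
Qed.

Lemma fermat_core_cent_chief a : a \in W -> p^'.-elt a -> a \in 'C(D).
Proof.
have /chief_factorP[nsDG _ ltDP _] := chP.
exact: fermat_core_hypercyclic_cent (pgroupS (proper_sub ltDP) pP) nsDG hypD.
Qed.

(* O centralises D, the three subgroup lemma makes P centralise D.            *)
(* [P, O] is normal in G and not contained in D, so it is all of P; as O       *)
(* centralises D, the three subgroup lemma shows that P centralises D.        *)
Lemma chief_pgroup_cent : P \subset 'C(D).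
Proof.
have /chief_factorP[nsDG nsPG ltDP _] := chP.
have [sPG nPG] := andP nsPG; have [sDG nDG] := andP nsDG.
have nsOG : O <| G by apply: p_residual_normal (fermat_core_normal p G).
have [sOG nOG] := andP nsOG.
have sPOP : [~: P, O] \subset P by rewrite commg_subl (subset_trans sOG).
have nsPO : [~: P, O] <| G.
  by rewrite /normal (subset_trans sPOP) //= normsR.
have defP : [~: P, O] = P.
  apply/eqP; apply: contraR ncycPD => neqP.
  exact: chief_cyclic_of_stable (maxD nsPO sPOP neqP).
have cDO : [~: O, D] = 1.
  apply/commG1P; rewrite gen_subG; apply/subsetP=> a; rewrite inE => /andP[Wa p'a].
  exact: fermat_core_cent_chief.
apply/commG1P; rewrite -defP; apply: (three_subgroup (H := D)).
  by rewrite cDO comm1G.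
apply/trivgP; rewrite -cDO (commGC O) commSg // commg_subl.
exact: subset_trans sPG nDG.
Qed.

Lemma chief_pgroup_abelem : p.-abelem (P / D).
Proof.
have solV : solvable (P / D) := quotient_sol D (pgroup_sol pP).
have [_ _ abV] := minnormal_solvable (chief_factor_minnormal chP) (subxx _) solV.
by rewrite -is_abelem_pgroup // quotient_pgroup.
Qed.

(** With n = [p_or_4 p P], P has class at most 2 and the elements y with y ^+ n = 1 form a normal
    subgroup [Om] of G. If [Om] is proper, it lies in D. But some p'-element a of W has [z, a]
    outside D, while a fixes z ^+ n in D, so that [z, a] ^+ n = 1. *)
Lemma chief_pgroup_exponent x : x \in P -> x ^+ p_or_4 p P = 1.
Proof.
have /chief_factorP[nsDG nsPG ltDP _] := chP.
have [sPG nPG] := andP nsPG; have [sDG nDG] := andP nsDG.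
have nDP := subset_trans sPG nDG; have sDP := proper_sub ltDP.
have [_ abV expV] := and3P chief_pgroup_abelem.
have cPD : D \subset 'C(P) by rewrite centsC chief_pgroup_cent.
have sP'D : P^`(1) \subset D by rewrite der1_min.
have XpD y : y \in P -> y ^+ p \in D.
  move=> Py; have nDy := subsetP nDP y Py.
  apply: coset_idr; first exact: groupX.
  by rewrite morphX //; apply: (exponentP expV); apply: mem_quotient.
have XnD y : y \in P -> y ^+ p_or_4 p P \in D.
  by move=> Py; have /dvdnP[k ->] := dvdn_p_or_4 p P; rewrite mulnC expgM groupX ?XpD.
have cPp y Py := subsetP cPD _ (XpD y Py).
have XnM := expgM_p_or_4 p_pr cPp (subset_trans sP'D cPD).
pose Om := [set y in P | y ^+ p_or_4 p P == 1].
have gOm : group_set Om.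
  apply/group_setP; split; first by rewrite inE group1 expg1n /=.
  move=> y z; rewrite !inE => /andP[Py /eqP yn] /andP[Pz /eqP zn].
  by rewrite groupM //= XnM // yn zn mulg1.
have sOmP : Om \subset P by apply/subsetP=> y; rewrite inE => /andP[].
have nsOm : group gOm <| G.
  rewrite /normal (subset_trans sOmP) //=; apply/normsP=> g Gg; apply/setP=> y.
  rewrite mem_conjg !inE memJ_norm ?groupV ?(subsetP nPG) // -conjXg.
  by rewrite conjg_eq1.
have defOm : Om = P.
  apply/eqP; apply/idPn => /(maxD nsOm sOmP) /= sOmD.
  have [a [z [Wa p'a Pz /negP[]]]] := ex_unstable_p'elt.
  have Ga : a \in G := subsetP (normal_sub (fermat_core_normal p G)) a Wa.
  have Pza : z ^ a \in P by rewrite memJ_norm ?(subsetP nPG).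
  have PR : [~ z, a] \in P by rewrite commgEl groupM ?groupV.
  apply: (subsetP sOmD); rewrite inE PR /=.
  have : (z ^ a) ^+ p_or_4 p P = z ^+ p_or_4 p P.
    rewrite -conjXg; apply/conjg_fixP/commgP/commute_sym.
    by apply: (centP (fermat_core_cent_chief Wa p'a)); apply: XnD.
  rewrite conjg_mulR XnM // => /(canRL (mulKg _)) ->.
  by rewrite mulVg.
by move=> Px; move: (Px); rewrite -[in X in X -> _]defOm inE => /andP[_ /eqP].
Qed.

End ChiefPGroup.

(* With Y = A this is supersolubility of A; the relative form, used with       *)
(* Y = A :&: E, is inherited when E is replaced by a smaller normal subgroup. *)
Definition normal_cyclic_chain (gT : finGroupType) (A Y : {set gT}) : Prop :=
  exists n (C : nat -> {group gT}),
    [/\ C 0%N :=: 1, Y \subset C n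
      & forall k, (k < n)%N ->
          [/\ C k \subset C k.+1, C k <| A, C k.+1 <| A
            & cyclic (C k.+1 / C k)]].

(** * Chains of normal subgroups with cyclic factors *)

Section NormalCyclicChain.

Variable gT : finGroupType.
Implicit Types (A B D E L X Y : {group gT}).

Lemma normal_cyclic_chainS A (Y Z : {set gT}) :
  Z \subset Y -> normal_cyclic_chain A Y -> normal_cyclic_chain A Z.
Proof.
by move=> sZY [n [C [C0 sYC stepC]]]; exists n, C; rewrite (subset_trans sZY).
Qed.

Lemma normal_cyclic_chainI A B (Y : {set gT}) :
    B \subset A -> Y \subset B -> normal_cyclic_chain A Y ->
  normal_cyclic_chain B Y.
Proof.
move=> sBA sYB [n [C [C0 sYC stepC]]]; exists n, (fun k => C k :&: B)%G.
split=> [||k ltkn]; first by rewrite /= C0 (setIidPl (sub1G B)).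
  by rewrite subsetI sYC.
have [sCk nsCk nsCk1 cycC] := stepC k ltkn.
split=> /=; first exact: setSI.
- by rewrite setIC (normalGI sBA).
- by rewrite setIC (normalGI sBA).
have nCX : C k.+1 :&: B \subset 'N(C k).
  by rewrite subIset // (subset_trans sBA) ?orbT ?normal_norm.
have -> : C k :&: B = C k :&: (C k.+1 :&: B).
  by rewrite setIA (setIidPl sCk).
rewrite (isog_cyclic (second_isog nCX)).
by apply: cyclicS cycC; rewrite quotientS ?subsetIl.
Qed.

Lemma normal_cyclic_chain_sol A : normal_cyclic_chain A A -> solvable A.
Proof.
case=> n [C [C0 sAC stepC]]; apply: solvableS sAC _.
elim: n stepC {-2}n (leqnn n) => [|n IHn] stepC m.
  by rewrite leqn0 => /eqP->; rewrite C0 solvable1.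
rewrite leq_eqVlt => /orP[/eqP-> | ltmn].
  have [sCn nsCn nsCn1 cycC] := stepC n (ltnSn n).
  have nsC : C n <| C n.+1 := normalS sCn (normal_sub nsCn1) nsCn.
  rewrite (series_sol nsC) (abelian_sol (cyclic_abelian cycC)) andbT.
  by apply: IHn => // k ltkn; apply: stepC; apply: ltnW.
by apply: IHn => // k ltkn; apply: stepC; apply: ltnW.
Qed.

(** Take L = D (C k :&: E) for the first k with C k :&: E not in D; then L / D is an image of a
    section of the cyclic factor C k / C k.-1. *)
Lemma normal_cyclic_step A D E :
    normal_cyclic_chain A (A :&: E) -> A \subset 'N(D) -> A \subset 'N(E) ->
    D \subset E -> ~~ (A :&: E \subset D) ->
  exists L : {group gT},
    [/\ D \proper L, L \subset E, A \subset 'N(L) & cyclic (L / D)].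
Proof.
case=> n [C [C0 sAEC stepC]] nDA nEA sDE nsAED.
have exk : exists k, ~~ (C k :&: E \subset D).
  exists n; apply: contra nsAED; apply: subset_trans.
  by rewrite subsetI sAEC subsetIr.
have [k nsCD mink] := ex_minnP exk.
have lekn : k <= n.
  apply: mink; apply: contra nsAED; apply: subset_trans.
  by rewrite subsetI sAEC subsetIr.
case: k lekn nsCD mink => [|k] ltkn nsCD mink.
  by rewrite C0 (setIidPl (sub1G E)) sub1G in nsCD.
have [sCk /andP[_ nCkA] /andP[sCkA nCk1A] cycC] := stepC k ltkn.
have sCD : C k :&: E \subset D by apply: contraT => /mink; rewrite ltnn.
pose X := (C k.+1 :&: E)%G.
have sXA : X \subset A by rewrite subIset ?sCkA.
have nDX := subset_trans sXA nDA; have nCX := subset_trans sXA nCkA.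
exists (D <*> X)%G; split.
- by rewrite properE joing_subl join_subG subxx /=.
- by rewrite join_subG sDE subsetIr.
- by rewrite normsY // normsI.
rewrite /= quotientYidl //.
have cycX : cyclic (X / (C k :&: X)).
  rewrite (isog_cyclic (second_isog nCX)).
  by apply: cyclicS cycC; rewrite quotientS ?subsetIl.
have sXD : C k :&: X \subset D.
  by apply: subset_trans sCD; rewrite setIS ?subsetIr.
have nIX : X \subset 'N(C k :&: X) by rewrite normsI ?normG.
have /homgP[f <-] := homg_quotientS nIX nDX sXD.
exact: morphim_cyclic.
Qed.

End NormalCyclicChain.

(** Otherwise L = D<x> with x of order p or 4. A q-element y, q outside pi, normalises <x>, hence L,
    or it lies in N, and then [L, y] lies in P :&: N, which is in D. So all primes are excluded from
    #|G : 'N_G(L)|, L is normal in G, and L = P is cyclic over D. *)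
Lemma chief_pgroup_cyclic (gT : finGroupType) (pi : nat_pred) (p : nat)
    (D P G L : {group gT}) :
    prime p -> p.-group P -> chief_factor G D P -> hypercyclic D G ->
    (forall M : {group gT}, M <| G -> M \subset P -> M :!=: P -> M \subset D) ->
    D \proper L -> L \subset P -> cyclic (L / D) -> pi^'.-nat #|G : 'N_G(L)| ->
    (forall (H : {group gT}) q y, H \subset P -> cyclic H ->
       #|H| = p \/ [/\ p = 2, #|H| = 4 & ~~ abelian P] ->
       q \notin pi -> y \in G -> q.-elt y ->
       (y \in 'N(H)) \/ exists2 N : {group gT}, N <| G &
         pi.-group (G / N) /\ ~~ (H \subset N)) ->
  cyclic (P / D).
Proof.
move=> p_pr pP chP hypD maxD ltDL sLP cycL pi'iL condH.
apply: contraT => ncycPD.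
have /chief_factorP[nsDG nsPG ltDP minP] := chP.
have [sPG nPG] := andP nsPG; have [sDG nDG] := andP nsDG.
have sDL := proper_sub ltDL.
have nDL : L \subset 'N(D) := subset_trans (subset_trans sLP sPG) nDG.
have [x Lx defL] : exists2 x, x \in L & L :=: D <*> <[x]>.
  have /cyclicP[xb defxb] := cycL.
  have : xb \in L / D by rewrite defxb cycle_id.
  case/morphimP=> x nDx Lx defx; exists x => //.
  have nDxc : <[x]> \subset 'N(D) by rewrite cycle_subG.
  apply/eqP; rewrite eqEsubset join_subG sDL cycle_subG Lx !andbT.
  rewrite norm_joinEr // -quotientSK // quotient_cycle // -defx -defxb.
  exact: subxx.
have notDx : x \notin D.
  apply: contra (proper_subn ltDL) => Dx.
  by rewrite defL join_subG subxx cycle_subG.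
have Px := subsetP sLP x Lx.
have ox : #[x] = p \/ [/\ p = 2, #[x] = 4 & ~~ abelian P].
  apply: (order_p_or_4 p_pr (chief_pgroup_exponent p_pr pP chP hypD ncycPD maxD Px)).
  by apply: contraNneq notDx => ->.
have nLq q y : q \notin pi -> y \in G -> q.-elt y -> y \in 'N(L).
  move=> pi'q Gy qy; have nDy := subsetP nDG y Gy.
  have sxP : <[x]> \subset P by rewrite cycle_subG.
  have [|[N nsNG [piGN nsxN]]] := condH <[x]>%G q y sxP (cycle_cyclic x) ox pi'q Gy qy.
    by move=> nxy; rewrite defL -cycle_subG normsY ?cycle_subG.
  have Ny : y \in N.
    apply: coset_idr; first exact: (subsetP (normal_norm nsNG)).
    have piy : pi.-elt (coset N y) by apply: mem_p_elt piGN (mem_quotient _ Gy).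
    have : q.-elt (coset N y) by apply: morph_p_elt; rewrite ?(subsetP (normal_norm nsNG)).
    move=> qNy; apply/eqP; rewrite -order_eq1; apply/eqP/(@pnat_1 pi) => //.
    apply: sub_in_pnat qNy => r _; rewrite !inE => /eqP ->.
    exact: pi'q.
  have sPND : P :&: N \subset D.
    apply: maxD; rewrite ?subsetIl ?normalI //.
    by apply: contra nsxN => /eqP/setIidPl; apply: subset_trans.
  apply/normP/eqP; rewrite eqEcard cardJg leqnn andbT.
  apply/subsetP=> _ /imsetP[z Lz ->]; rewrite conjg_mulR groupM //.
  apply: (subsetP sDL); apply: (subsetP sPND); have Pz := subsetP sLP z Lz.
  rewrite inE; apply/andP; split.
    by rewrite commgEl groupM ?groupV ?memJ_norm ?(subsetP nPG).
  by rewrite commgEr groupM // memJ_norm ?groupV // (subsetP (normal_norm nsNG)) ?(subsetP sPG).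
have nLG : G \subset 'N(L).
  have sNG : 'N_G(L) \subset G := subsetIl _ _.
  apply/setIidPl/eqP; rewrite eqEsubset sNG /= -indexg_eq1.
  apply/eqP/(@pnat_1 pi) => //.
  apply/pnatP=> // q q_pr; apply: contraTT => pi'q.
  have [Q sylQ] := Sylow_exists q G; have [sQG qQ q'GQ] := and3P sylQ.
  have sQN : Q \subset 'N_G(L).
    rewrite subsetI sQG; apply/subsetP=> y Qy.
    exact: nLq pi'q (subsetP sQG y Qy) (mem_p_elt qQ Qy).
  rewrite -p'natE //; apply: pnat_dvd q'GQ.
  by rewrite -(Lagrange_index sNG sQN) dvdn_mulr.
have nsLG : L <| G by rewrite /normal (subset_trans sLP).
have [defLD | defLP] := minP L nsLG sDL sLP.
  by rewrite defLD properxx in ltDL.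
by rewrite -defLP cycL in ncycPD.
Qed.

(** Since Y :&: N = 1, Z |-> N Z carries chief factors of X below Y to isomorphic chief factors of G
    below D. *)
Lemma hypercyclic_supplement (gT : finGroupType) (D G N X Y : {group gT}) :
    N <| G -> N \subset D -> hypercyclic D G -> X \subset G -> G \subset N * X ->
    Y \subset D -> Y :&: N = 1 ->
  hypercyclic Y X.
Proof.
move=> nsNG sND hypD sXG sGNX sYD tiYN V U chU sUY.
have /chief_factorP[/andP[sVX nVX] /andP[sUX nUX] ltVU minU] := chU.
have [sNG nNG] := andP nsNG; have sVU := proper_sub ltVU.
have tiUN : U :&: N = 1 by apply/trivgP; rewrite -tiYN setSI.
have nNX := subset_trans sXG nNG; have nNU := subset_trans sUX nNX.
have normalNJ (Z : {group gT}) : Z \subset X -> X \subset 'N(Z) -> N <*> Z <| G.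
  move=> sZX nZX; rewrite /normal join_subG sNG (subset_trans sZX) //=.
  apply: subset_trans sGNX _; rewrite mulG_subG (normsY nNX nZX) andbT.
  exact: subset_trans (joing_subl _ _) (normG _).
have dedekind (M : {group gT}) : M \subset U -> U :&: (N <*> M) = M.
  move=> sMU; have nNM := subset_trans sMU nNU.
  by rewrite norm_joinEr // -(normC nNM) setIC -group_modl // [N :&: U]setIC tiUN mulg1.
have nsVG := normalNJ V sVX nVX.
suff chNU : chief_factor G (N <*> V)%G (N <*> U)%G.
  have cycNU : cyclic ((N <*> U) / (N <*> V)).
    by apply: hypD chNU _; rewrite join_subG sND (subset_trans sUY).
  have nJU : U \subset 'N(N <*> V).
    by apply: subset_trans (normal_norm nsVG); apply: subset_trans sXG.
  have defNU : N <*> U = (N <*> V) <*> U.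
    by rewrite -joingA; congr (N <*> _); apply/esym/joing_idPr.
  move: cycNU; rewrite defNU /= quotientYidl //.
  by rewrite -(isog_cyclic (second_isog nJU)) /= setIC dedekind.
apply/chief_factorP; split; rewrite ?normalNJ //.
  rewrite properE join_subG joing_subl (subset_trans sVU) ?joing_subr //=.
  apply: contra (proper_subn ltVU); rewrite join_subG => /andP[_ sUNV].
  by rewrite -(dedekind V sVU) subsetI subxx.
move=> M nsMG sVM sMU; have sNM := subset_trans (joing_subl N V) sVM.
have sMIU : M :&: U \subset U := subsetIr _ _.
have defM : M :=: N <*> (M :&: U).
  have nNMU := subset_trans sMIU nNU.
  by rewrite norm_joinEr //= setIC group_modl // -norm_joinEr // (setIidPr sMU).
have nsMU : M :&: U <| X.
  rewrite /normal (subset_trans sMIU) //= normsI //.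
  exact: subset_trans sXG (normal_norm nsMG).
have sVMU : V \subset M :&: U.
  by rewrite subsetI sVU (subset_trans (joing_subr N V)).
rewrite defM; case: (minU (M :&: U)%G nsMU sVMU sMIU) => /= ->; first by left.
by right.
Qed.

Lemma Sylow_tower_pcore_p' (gT : finGroupType) (X : {group gT}) p :
  (forall q, q \in \pi(X) -> p <= q) -> Sylow_tower X ->
  p^'.-Hall(X) 'O_p^'(X).
Proof.
move=> minp /(_ p) hallX.
have eq_pi : {in \pi(X), primes_above p =i p^'}.
  move=> q /minp; rewrite leq_eqVlt !inE eq_sym => /orP[/eqP->|ltpq].
    by rewrite ltnn eqxx.
  by rewrite ltpq neq_ltn ltpq orbT.
by rewrite -(eq_in_pHall _ eq_pi) -[X in _.-Hall(_) X](eq_in_pcore eq_pi).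
Qed.

(** * Hypercentral subgroups and coprime elements *)

(** A cyclic chief factor is centralised by G' = G, so each one below D is a step in the upper
    central series. *)
Lemma hypercyclic_perfect_ucn (gT : finGroupType) (D G : {group gT}) :
    G^`(1) = G -> D <| G -> hypercyclic D G ->
  exists n, D \subset 'Z_n(G).
Proof.
move=> perfG; have [m] := ubnP #|D|; elim: m D => // m IHm D /ltnSE-leDm nsDG hypD.
have [-> | ntD] := eqsVneq D 1; first by exists 0%N; apply: sub1G.
have [K chK] := ex_chief_factor_below nsDG ntD.
have /chief_factorP[nsKG _ ltKD _] := chK; have sKD := proper_sub ltKD.
have [|n sKZ] := IHm K (leq_trans (proper_card ltKD) leDm) nsKG.
  exact: hypercyclicS hypD.
exists n.+1; have [sKG nKG] := andP nsKG.
have nDKG : G / K \subset 'N(D / K) by rewrite quotient_norms ?normal_norm.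
have : [~: D, G] \subset K.
  rewrite -quotient_cents2 ?(subset_trans (normal_sub nsDG)) //.
  rewrite centsC -{1}perfG quotient_der //.
  exact: der1_cent_cyclic (hypD _ _ chK (subxx D)) nDKG.
move/subset_trans/(_ sKZ) => sDGZ.
have nZG := ucn_norm n G; have nZD := subset_trans (normal_sub nsDG) nZG.
rewrite ucnSn -sub_quotient_pre // subsetI (quotientS _ (normal_sub nsDG)).
exact: quotient_cents2r.
Qed.

(** The p'-element y stabilises the series of subgroups 'O_p('Z_n(G)), so coprime action applies. *)
Lemma ucn_coprime_cent (gT : finGroupType) (p : nat) (G : {group gT}) n y :
  y \in G -> p^'.-elt y -> y \in 'C('O_p('Z_n(G))).
Proof.
move=> Gy p'y; elim: n => [|n IHn].
  have -> : 'O_p('Z_0(G)) = 1 by apply/trivgP; rewrite -(ucn0 G) pcore_sub.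
  by rewrite cent1T inE.
have chQ m : 'O_p('Z_m(G)) <| G.
  exact: char_normal_trans (pcore_char p _) (ucn_normal m G).
have pQ m : p.-group 'O_p('Z_m(G)) := pcore_pgroup p _.
have nQ m : G \subset 'N('O_p('Z_m(G))) := normal_norm (chQ m).
have defQ : 'O_p('Z_n.+1(G)) :&: 'Z_n(G) = 'O_p('Z_n(G)).
  exact: pcore_setI_normal (ucn_normalS n G).
rewrite -cycle_subG; apply: (@stable_factor_coprime_cent _ _ _ 'O_p('Z_n(G))%G).
- exact: pnat_coprime (pQ _) p'y.
- exact: pgroup_sol (pQ _).
- by rewrite /= -defQ subsetIl.
- exact: subset_trans (normal_sub (chQ _)) (nQ n).
- rewrite /= -defQ subsetI commg_subl cycle_subG (subsetP (nQ _)) //=.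
  apply: subset_trans (ucn_comm n G).
  by rewrite commgSS ?pcore_sub // cycle_subG.
by rewrite cycle_subG.
Qed.

Lemma ucn_pgroup_cent (gT : finGroupType) (p : nat) (G H : {group gT}) n y :
    p.-group H -> H \subset 'Z_n(G) -> y \in G -> p^'.-elt y ->
  y \in 'C(H).
Proof.
move=> pH sHZ Gy p'y; apply: (subsetP (centS _) y (ucn_coprime_cent n Gy p'y)).
have nilZ := ucn_nilpotent n G.
by rewrite (sub_normal_Hall (nilpotent_pcore_Hall p nilZ)) ?pcore_normal.
Qed.

(** * Modular and permutable subgroups under coprime elements *)

Section Modular.

Variable gT : finGroupType.
Implicit Types (A B G H X Z : {group gT}).

(** By modularity <H, y> :&: Z = <H, <[y]> :&: Z> = H, and y normalises both groups on the left. In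
    [permutable_norm] Dedekind's law plays the same part. *)
Lemma modular_norm G H Z y :
    modular_subgroup H G -> Z \subset G -> H \subset Z -> y \in G ->
    coprime #|Z| #[y] -> y \in 'N(Z) ->
  y \in 'N(H).
Proof.
case=> sHG _ modH sZG sHZ Gy coZy nZy.
have := modH <[y]>%G Z; rewrite cycle_subG => /(_ Gy sZG sHZ).
rewrite [<[y]> :&: Z]setIC (coprime_TIg coZy) joingG1 => ->.
rewrite -cycle_subG normsI ?cycle_subG // (subsetP (normG _)) //.
by apply: (subsetP (joing_subr _ _)); apply: cycle_id.
Qed.

Lemma permutable_norm A H Z y :
    H * A = A * H -> H \subset Z -> y \in A -> coprime #|Z| #|A| ->
    y \in 'N(Z) ->
  y \in 'N(H).
Proof.
move=> permHA sHZ Ay coZA nZy.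
have : (H <*> A) :&: Z = H.
  by rewrite comm_joingE // -group_modl // setIC coprime_TIg // mulg1.
move=> <-; rewrite -cycle_subG normsI ?cycle_subG // (subsetP (normG _)) //.
exact: (subsetP (joing_subr _ _)).
Qed.

Lemma modular_subgroupS G H X :
  modular_subgroup H G -> H \subset X -> X \subset G -> modular_subgroup H X.
Proof.
case=> _ mod1 mod2 sHX sXG; split=> // [Y Z sYZ sZX | Y Z sYX sZX sHZ].
  by apply: mod1 => //; apply: subset_trans sXG.
by apply: mod2 => //; apply: subset_trans sXG.
Qed.

Lemma conjsYg (A B : {group gT}) x : (A <*> B) :^ x = A :^ x <*> B :^ x.
Proof. by rewrite /joing -genJ conjUg. Qed.

Lemma modular_subgroupJ G H x :
  x \in G -> modular_subgroup H G -> modular_subgroup (H :^ x)%G G.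
Proof.
move=> Gx [sHG mod1 mod2].
have sJG Z : (Z :^ x^-1 \subset G) = (Z \subset G).
  by rewrite sub_conjgV conjGid.
split=> [|Y Z sYZ sZG | Y Z sYG sZG sHZ].
- by rewrite /= -(conjGid Gx) conjSg.
- have := mod1 (Y :^ x^-1)%G (Z :^ x^-1)%G; rewrite /= conjSg sJG => /(_ sYZ sZG).
  move/(congr1 (conjugate^~ x)); rewrite conjIg !conjsYg conjIg.
  by rewrite !conjsgKV.
have := mod2 (Y :^ x^-1)%G (Z :^ x^-1)%G; rewrite /= !sJG -sub_conjg.
move/(_ sYG sZG sHZ)/(congr1 (conjugate^~ x)).
by rewrite conjIg !conjsYg conjIg !conjsgKV.
Qed.

(* = H by modularity, so Burnside gives W a normal p-complement Q, and        *)
(* modularity again yields Q = <y>.                                           *)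
(* A Sylow subgroup S of W = <H, y> containing H is <H, S /\ <y>> = H by       *)
(* modularity, so Burnside gives W a normal p-complement Q, and modularity    *)
(* again yields Q = <y>.                                                      *)
Lemma modular_min_prime_norm (p : nat) G H y :
    prime p -> (forall q, q \in \pi(G) -> p <= q) ->
    p.-group H -> cyclic H -> modular_subgroup H G -> y \in G -> p^'.-elt y ->
  H \subset 'N(<[y]>).
Proof.
move=> p_pr minp pH cycH modH Gy p'y; have [sHG mod1 mod2] := modH.
pose W := (H <*> <[y]>)%G.
have sHW : H \subset W := joing_subl _ _.
have syW : <[y]> \subset W := joing_subr _ _.
have sWG : W \subset G by rewrite join_subG sHG cycle_subG.
have [S sylS sHS] := Sylow_superset sHW pH; have [sSW pS _] := and3P sylS.
have sSG := subset_trans sSW sWG; have syG := subset_trans syW sWG.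
have defS : H :=: S.
  have := mod2 <[y]>%G S syG sSG sHS.
  rewrite [<[y]> :&: S]setIC (coprime_TIg (pnat_coprime pS p'y)) joingG1.
  by rewrite (setIidPr sSW).
have cycS : cyclic S by rewrite -defS.
have hallQ : p^'.-Hall(W) 'O_p^'(W).
  by apply: Burnside_min_prime sylS cycS _ => // q /(piSg sWG)/minp.
have syQ : <[y]> \subset 'O_p^'(W).
  by rewrite (sub_normal_Hall hallQ) ?pcore_normal.
have := mod1 <[y]>%G 'O_p^'(W)%G syQ (subset_trans (pcore_sub _ _) sWG).
rewrite /= (coprime_TIg (pnat_coprime pH (pcore_pgroup _ _))) joingG1 joingC.
rewrite (setIidPr (pcore_sub _ _)) => ->.
exact: subset_trans sHW (gFnorm _ _).
Qed.

End Modular.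

(** * The hypotheses in hereditary form *)

Section Controlled.

Variables (I : Type) (sigma : I -> nat_pred) (gT : finGroupType).
Implicit Types (i : I) (A D E G H K L M N P X Z : {group gT}).

(** No Hall set is mentioned, so the property passes to subgroups of G containing H. *)
Definition locally_normalised i H G : Prop :=
  forall q y Z, q \notin sigma i -> y \in G -> q.-elt y ->
    Z \subset G -> (sigma i).-group Z -> H \subset Z ->
  y \in 'N(Z) -> y \in 'N(H).

(* What remains of weak permutability, in a form inherited by subgroups of G   *)
(* containing H: the cases are a modular H, an H all of whose conjugates      *)
(* permute with the given Hall subgroups, a supplement T <> G, and an H of    *)
(* order 4 in the hypercentre.                                                *)
Definition controlled i H G : Prop :=
  [\/ modular_subgroup H G,
      locally_normalised i H G /\
        (exists2 N : {group gT}, N <| G & (sigma i).-group N /\ H \subset N),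
      exists2 N : {group gT}, N <| G & (sigma i).-group (G / N) /\ ~~ (H \subset N)
    | forall y, y \in G -> coprime #|H| #[y] -> y \in 'C(H)].

(** Non-cyclic p-subgroups P replace the Hall subgroups of E, so that E can be replaced by a smaller
    subgroup. *)
Definition small_subgroups_controlled G E : Prop :=
  forall i p P H,
    p \in sigma i -> P \subset E -> p.-group P -> ~~ cyclic P ->
    H \subset P -> cyclic H ->
    #|H| = p \/ [/\ p = 2, #|H| = 4 & ~~ abelian P] ->
  controlled i H G.

Lemma controlledS i H G X :
  H \subset X -> X \subset G -> controlled i H G -> controlled i H X.
Proof.
move=> sHX sXG [modH | [nHl [N nsNG [iN sHN]]] | [N nsNG [iGN nsHN]] | cH].
- by constructor 1; apply: modular_subgroupS sXG.
- constructor 2; split=> [q y Z qi Xy qy sZX|].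
    apply: (nHl q y Z qi _ qy); first exact: (subsetP sXG).
    exact: subset_trans sXG.
  exists (X :&: N)%G; first exact: normalGI sXG nsNG.
  by rewrite subsetI sHX (pgroupS (subsetIr X N)).
- constructor 3; exists (X :&: N)%G; first exact: normalGI sXG nsNG.
  have nNX := subset_trans sXG (normal_norm nsNG).
  split; last by rewrite subsetI sHX.
  rewrite /pgroup /= setIC (card_isog (second_isog nNX)).
  exact: pgroupS (quotientS N sXG) iGN.
by constructor 4 => y Xy; apply: cH; apply: (subsetP sXG).
Qed.

Lemma controlled_norm_or i H G P q y :
    P \subset G -> (sigma i).-group P -> H \subset P ->
    controlled i H G -> q \notin sigma i -> y \in G -> q.-elt y -> y \in 'N(P) ->
  y \in 'N(H) \/ exists2 N : {group gT}, N <| G &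
    (sigma i).-group (G / N) /\ ~~ (H \subset N).
Proof.
move=> sPG iP sHP ctrlH qi Gy qy nPy.
have coPy : coprime #|P| #[y].
  apply: (pnat_coprime iP); apply: sub_in_pnat qy => r _ /eqnP->.
  exact: qi.
case: ctrlH => [modH | [nH _] | | cH]; [left | left | by right | left].
- exact: modular_norm modH sPG sHP Gy coPy nPy.
- exact: nH qi Gy qy sPG iP sHP nPy.
apply: (subsetP (cent_sub H) y (cH y Gy _)).
exact: coprimeSg coPy.
Qed.

End Controlled.

(** * The induction *)

Section Main.

Variables (I : Type) (sigma : I -> nat_pred) (gT : finGroupType).
Implicit Types (i : I) (A D E G H K L M N P U X Z : {group gT}).

Hypothesis sigma_cover : forall p, prime p -> exists i, p \in sigma i.

Definition supersolubly_Hall G E : Prop :=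
  forall i, exists2 A : {group gT},
    (sigma i).-Hall(G) A & normal_cyclic_chain A (A :&: E).

Lemma controlled_full_cyclic D G :
    chief_factor G D G -> hypercyclic D G ->
    (forall M, M <| G -> M :!=: G -> M \subset D) ->
    supersolubly_Hall G G -> small_subgroups_controlled sigma G G ->
  cyclic (G / D).
Proof.
move=> chD hypD maxD hallG ctrlG; apply: contraT => ncycGD.
have /chief_factorP[nsDG _ ltDG _] := chD.
have [sDG nDG] := andP nsDG.
have nsolGD : ~~ solvable (G / D).
  apply: contra ncycGD => solGD; apply: prime_cyclic.
  apply: simple_sol_prime solGD _; rewrite quotient_simple //.
  by case/andP: chD.
have nsolG : ~~ solvable G by apply: contra nsolGD; apply: quotient_sol.
have perfG : G^`(1) = G.
  apply/eqP; apply: contraR nsolGD => /(maxD _ (der_normal 1 G)) sG'D.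
  by rewrite abelian_sol ?sub_der1_abelian.
have solHall i A : (sigma i).-Hall(G) A -> normal_cyclic_chain A (A :&: G) -> solvable A.
  by move=> hallA; rewrite (setIidPl (pHall_sub hallA)); apply: normal_cyclic_chain_sol.
have [n sDZ] := hypercyclic_perfect_ucn perfG nsDG hypD.
have ntG : G :!=: 1 by apply: contraNneq nsolG => ->; apply: solvable1.
have G_gt1 : 1 < #|G| by rewrite cardG_gt1.
set p := pdiv #|G|; have p_pr : prime p by apply: pdiv_prime.
have minp q : q \in \pi(G) -> p <= q.
  by rewrite mem_primes => /and3P[q_pr _]; apply: pdiv_min_dvd (prime_gt1 q_pr).
have [i pi_p] := sigma_cover p_pr.
have [A hallA chA] := hallG i; have solA := solHall i A hallA chA.
(* If H is in D, it is hypercentral. If not, the first three alternatives make G or G / D soluble or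
   put H in D: a modular H would have conjugates generating G and normalising every cyclic
   p'-subgroup, so that O^p(G) would be central in the perfect group G. The fourth is the claim
   itself. *)
have ctrl_cent H a : H \subset G -> p.-group H -> cyclic H ->
    controlled sigma i H G -> a \in G -> p^'.-elt a -> a \in 'C(H).
  move=> sHG pH cycH ctrlH Ga p'a.
  have [sHD | nsHD] := boolP (H \subset D).
    exact: ucn_pgroup_cent pH (subset_trans sHD sDZ) Ga p'a.
  case: ctrlH => [modH | [_ [N nsNG [iN sHN]]] | [N nsNG [iGN nsHN]] | cH].
  - pose R := p_residual_group p G.
    have cycnorm y : y \in G -> p^'.-elt y -> G \subset 'N(<[y]>).
      move=> Gy p'y; pose HG := <<class_support H G>>%G.
      have nsHGG : HG <| G.
        rewrite /normal gen_subG class_support_subG //=.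
        by rewrite norms_gen ?class_support_norm.
      have defHG : HG :=: G.
        apply/eqP; apply: contraR nsHD => /(maxD HG nsHGG); apply: subset_trans.
        exact: subset_trans (sub_class_support _ _) (subset_gen _).
      rewrite -defHG gen_subG class_supportEr; apply/bigcupsP=> g Gg.
      apply: (modular_min_prime_norm (H := (H :^ g)%G) p_pr minp _ _ _ Gy p'y).
      + by rewrite pgroupJ.
      + by rewrite cyclicJ.
      exact: modular_subgroupJ.
    have cGR : R \subset 'Z(G).
      rewrite gen_subG; apply/subsetP=> y; rewrite inE => /andP[Gy p'y].
      rewrite inE Gy -sub_cent1 -cent_cycle -{1}perfG.
      exact: der1_cent_cyclic (cycle_cyclic y) (cycnorm y Gy p'y).
    case/negP: nsolG; rewrite (series_sol (p_residual_normal p (normal_refl G))).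
    rewrite (solvableS cGR (abelian_sol (center_abelian G))) /=.
    have pQ : p.-group (G / R).
      rewrite /pgroup card_quotient ?p_residual_index //.
      exact: normal_norm (p_residual_normal p (normal_refl G)).
    exact: pgroup_sol pQ.
  - have [defN | neNG] := eqsVneq N G.
      have iG : (sigma i).-group G by rewrite -defN.
      case/negP: nsolG; rewrite -(_ : A :=: G) //.
      apply/eqP; rewrite eqEcard (pHall_sub hallA) (card_Hall hallA).
      by rewrite part_pnat_id //= leqnn.
    by rewrite (subset_trans sHN) ?maxD in nsHD.
  - have sND : N \subset D.
      apply: maxD => //; apply: contraNneq nsHN => ->; exact: sHG.
    case/negP: nsolGD.
    have iGD : (sigma i).-group (G / D).
      have [f <-] := homgP (homg_quotientS (normal_norm nsNG) nDG sND).
      exact: morphim_pgroup.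
    have hallAD := quotient_pHall (subset_trans (pHall_sub hallA) nDG) hallA.
    rewrite -(_ : A / D = G / D) ?quotient_sol //.
    apply/eqP; rewrite eqEcard (pHall_sub hallAD) (card_Hall hallAD).
    by rewrite part_pnat_id //= leqnn.
  apply: cH => //; exact: pnat_coprime pH p'a.
have local U a : U \subset G -> p.-group U -> a \in 'N_G(U) -> p^'.-elt a -> a \in 'C(U).
  move=> sUG pU /setIP[Ga nUa] p'a.
  have [cycU | ncycU] := boolP (cyclic U).
    apply: (min_prime_cyclic_cent p_pr pU) => // q q_pr q_dvd.
    by rewrite minp // mem_primes q_pr cardG_gt0 (dvdn_trans q_dvd) ?order_dvdG.
  apply: (p'elt_cent_p_or_4 p_pr) => // x Ux xn.
  have [-> | ntx] := eqVneq x 1; first by apply/cent1P/commute1.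
  rewrite -cent_cycle; apply: ctrl_cent => //.
  - by rewrite cycle_subG (subsetP sUG).
  - exact: mem_p_elt pU Ux.
  - exact: cycle_cyclic.
  apply: (ctrlG i p U <[x]>%G) => //.
  - by rewrite cycle_subG.
  - exact: cycle_cyclic.
  exact: order_p_or_4 xn ntx.
have [P sylP] := Sylow_exists p G; have [sPG pP p'iGP] := and3P sylP.
(* As G' = G, this reads P <= P', so the p-group P is trivial although p divides #|G|. *)
have := Frobenius_focal local sylP; rewrite perfG (setIidPl sPG) => sPP'.
have [P1 | ntP] := eqsVneq P 1.
  have : p^'.-group G by rewrite /pgroup -(indexg1 G) -P1.
  by rewrite /pgroup p'natE // pdiv_dvd.
by have := sol_der1_proper (pgroup_sol pP) (subxx P) ntP; rewrite properE sPP' andbF.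
Qed.

(** The tower gives E = N P with N = 'O_p^'(E) contained in D, and Frattini gives G = N X with X =
    'N_G(P). So E / D becomes the chief p-factor P / (P :&: D) of X. *)
Lemma controlled_tower_cyclic D E G :
    E <| G -> Sylow_tower E -> chief_factor G D E -> hypercyclic D G ->
    (forall M, M <| G -> M \subset E -> M :!=: E -> M \subset D) ->
    supersolubly_Hall G E -> small_subgroups_controlled sigma G E ->
  cyclic (E / D).
Proof.
move=> nsEG towE chE hypD maxD hallG ctrl; apply: contraT => ncycED.
have /chief_factorP[nsDG _ ltDE _] := chE.
have [sEG nEG] := andP nsEG; have [sDG nDG] := andP nsDG.
have sDE := proper_sub ltDE.
have E_gt1 : 1 < #|E|.
  by rewrite cardG_gt1; apply: contraTneq ltDE => ->; rewrite /proper sub1G andbF.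
set p := pdiv #|E|; have p_pr : prime p by apply: pdiv_prime.
have hallN : p^'.-Hall(E) 'O_p^'(E).
  apply: Sylow_tower_pcore_p' => // q; rewrite mem_primes => /and3P[q_pr _ dvqE].
  exact: pdiv_min_dvd (prime_gt1 q_pr) dvqE.
set N := 'O_p^'(E)%G in hallN.
have nsNG : N <| G := char_normal_trans (pcore_char _ _) nsEG.
have [sNE p'N _] := and3P hallN; have [sNG nNG] := andP nsNG.
have sND : N \subset D.
  apply: maxD => //; apply: contraTneq p'N => /= ->.
  by rewrite /pgroup p'natE // pdiv_dvd.
have [i pi_p] := sigma_cover p_pr.
have [A hallA chA] := hallG i; have [sAG iA _] := and3P hallA.
have hallAE : (sigma i).-Hall(E) (A :&: E) := Hall_setI_normal nsEG hallA.
have [P sylPA] := Sylow_exists p (A :&: E).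
have sylP : p.-Sylow(E) P := subHall_Sylow hallAE pi_p sylPA.
have [sPE pP _] := and3P sylP; have sPAE := pHall_sub sylPA.
have iP : (sigma i).-group P := pgroupS (subset_trans sPAE (subsetIl A E)) iA.
have tiPN : P :&: N = 1 := coprime_TIg (pnat_coprime pP p'N).
have defE : N * P = E.
  apply/eqP; rewrite eqEcard mul_subG //= coprime_cardMg.
    by rewrite (card_Hall sylP) (card_Hall hallN) mulnC partnC.
  by rewrite coprime_sym (pnat_coprime pP).
have sEDP : E \subset D * P by rewrite -defE mulSg.
have nsPD : ~~ (P \subset D).
  apply: contra (proper_subn ltDE) => sPD.
  by rewrite (subset_trans sEDP) // mul_subG.
have nsAED : ~~ (A :&: E \subset D) by apply: contra nsPD; apply: subset_trans.
(* A contains P, which is not in D, so the chain of A leaves D inside E. *)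
have [L [ltDL sLE nLA cycL]] :=
  normal_cyclic_step chA (subset_trans sAG nDG) (subset_trans sAG nEG) sDE nsAED.
have sDL := proper_sub ltDL; have sNL := subset_trans sND sDL.
pose X := 'N_G(P)%G; have sXG : X \subset G := subsetIl _ _.
have sPX : P \subset X by rewrite subsetI (subset_trans sPE sEG) normG.
have nsPX : P <| X by rewrite /normal sPX subsetIr.
have sGNX : G \subset N * X.
  rewrite -(Frattini_arg nsEG sylP) -defE -mulgA mulgS //.
  by rewrite mul_subG.
have sGDX : G \subset D * X := subset_trans sGNX (mulSg X sND).
have chP := chief_factor_supplement chE sXG sGDX nsPX sPE sEDP.
have nsDE : D <| E := normalS sDE sEG nsDG.
suffices cycPD : cyclic (P / (P :&: D)).
  by rewrite (cyclic_quotient_supplement nsDE sPE sEDP cycPD) in ncycED.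
have nDP := subset_trans sPE (normal_norm nsDE).
pose L1 := (P :&: L)%G.
have defL : L :=: D <*> L1.
  have defL : N * L1 = L by rewrite group_modl // defE (setIidPr sLE).
  apply/eqP; rewrite eqEsubset join_subG sDL subsetIr !andbT -{1}defL.
  by rewrite norm_joinEr ?(subset_trans (subsetIl P L)) // mulSg.
have nDL1 : L1 \subset 'N(D) := subset_trans (subsetIl P L) nDP.
have nL1X : 'N_X(L) \subset 'N(L1).
  rewrite normsI ?subsetIr //.
  exact: subset_trans (subsetIl X _) (normal_norm nsPX).
apply: (@chief_pgroup_cyclic _ (sigma i) p (P :&: D)%G P X L1) => //.
- apply: hypercyclic_supplement nsNG sND hypD sXG sGNX _ _.
    exact: subsetIr.
  by apply/trivgP; rewrite -tiPN setSI ?subsetIl.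
- move=> M nsMX sMP neMP; rewrite subsetI sMP /=.
  have [sMX nMX] := andP nsMX; have nNX := subset_trans sXG nNG.
  have nNM : M \subset 'N(N) := subset_trans sMX nNX.
  apply: subset_trans (joing_subr N M) _; apply: (maxD (N <*> M)%G).
  + rewrite /normal join_subG sNG (subset_trans sMX) //=.
    rewrite (subset_trans sGNX) // mulG_subG (normsY nNX nMX) andbT.
    exact: subset_trans (joing_subl N M) (normG _).
  + by rewrite join_subG sNE (subset_trans sMP).
  apply: contra neMP => /eqP defNM; rewrite eqEsubset sMP /=.
  have : M * (N :&: P) = P.
    rewrite group_modl //; apply/setIidPr.
    by rewrite (normC nNM) -norm_joinEr // defNM.
  by rewrite setIC tiPN mulg1 => ->.
- rewrite properE setIS //=; apply: contra (proper_subn ltDL).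
  by rewrite subsetI => /andP[_ sL1D]; rewrite defL join_subG subxx.
- exact: subsetIl.
- move: cycL; rewrite defL /= quotientYidl // -(isog_cyclic (second_isog nDL1)).
  by rewrite /= setIC -setIA (setIidPr sDL).
- have nLN : N \subset 'N_G(L) by rewrite subsetI sNG (subset_trans sNL) ?normG.
  have sNXL : 'N_X(L) \subset 'N_X(L1) by rewrite subsetI subsetIl nL1X.
  have eqG : X * 'N_G(L) = G.
    apply/eqP; rewrite eqEsubset mul_subG ?subsetIl //=.
    apply: subset_trans sGNX _; rewrite -(normC (subset_trans sXG nNG)).
    exact: mulgS.
  (* N normalises L, as it lies in L; hence X 'N_G(L) = G and the index is the same in X, where A
     need not lie. *)
  have iXL : #|X : 'N_X(L)| = #|G : 'N_G(L)|.
    have -> : 'N_X(L) = X :&: 'N_G(L) by rewrite setIA (setIidPl sXG).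
    rewrite indexgI; apply/eqP; rewrite -(eqn_pmul2r (cardG_gt0 'N_G(L))).
    by rewrite LagrangeMr /= eqG mulnC Lagrange ?subsetIl.
  have sAN : A \subset 'N_G(L) by rewrite subsetI sAG.
  have i'GL : (sigma i)^'.-nat #|G : 'N_G(L)|.
    apply: (pnat_dvd (n := #|G : A|)); last by case/and3P: hallA.
    by rewrite -(Lagrange_index (subsetIl G 'N(L)) sAN) dvdn_mulr.
  apply: pnat_dvd i'GL; rewrite -iXL.
  by rewrite -(Lagrange_index (subsetIl X 'N(L1)) sNXL) dvdn_mulr.
move=> H q y sHP cycH oH qi Xy qy.
have sHX := subset_trans sHP sPX.
have ncycP : ~~ cyclic P.
  apply: contra ncycED => cycP; apply: cyclic_quotient_supplement nsDE sPE sEDP _.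
  exact: quotient_cyclic.
have ctrlH : controlled sigma i H X.
  by apply: controlledS sHX sXG _; apply: ctrl sPE pP ncycP sHP cycH oH.
apply: (controlled_norm_or sPX iP sHP ctrlH qi Xy qy).
exact: subsetP (normal_norm nsPX) y Xy.
Qed.

Lemma hypercyclic_of_controlled G E :
    E <| G -> supersolubly_Hall G E ->
    small_subgroups_controlled sigma G E ->
  hypercyclic E G.
Proof.
have [m] := ubnP (#|G| + #|E|).
elim: m G E => // m IHm G E /ltnSE-leGEm nsEG hallG ctrl K L chK sLE.
have [sEG nEG] := andP nsEG.
have IHG M : M <| G -> M \subset E -> M :!=: E -> hypercyclic M G.
  move=> nsMG sME neME; apply: IHm => // [|i|i p P H pip sPM].
  - by apply: leq_trans leGEm; rewrite ltn_add2l proper_card // properEneq neME.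
  - have [A hallA chA] := hallG i; exists A => //.
    by apply: normal_cyclic_chainS chA; rewrite setIS.
  by apply: ctrl => //; apply: subset_trans sME.
have /chief_factorP[nsKG nsLG ltKL minL] := chK.
have [defL | neLE] := eqsVneq L E; last exact: (IHG L nsLG sLE neLE) K L chK (subxx L).
have {nsLG chK} chE : chief_factor G K E by rewrite -defL.
rewrite {sLE}defL in ltKL minL *; rename K into D.
have [// | ncycED] := boolP (cyclic (E / D)).
have maxD M : M <| G -> M \subset E -> M :!=: E -> M \subset D.
  by move=> nsMG sME neME; apply: (normal_sub_chief chE ncycED (IHG M _ _ _)).
have hypD : hypercyclic D G by apply: IHG; rewrite ?proper_sub ?proper_neq.
suffices cycED : cyclic (E / D) by rewrite cycED in ncycED.
have [/val_inj defE | neEG] := eqsVneq E G.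
  subst E; apply: (controlled_full_cyclic chE hypD _ hallG ctrl) => M nsMG.
  by apply: maxD; rewrite ?normal_sub.
have ltEG : E \proper G by rewrite properEneq neEG.
apply: (controlled_tower_cyclic nsEG _ chE) => //.
(* The induction hypothesis is used with E in the role of G as well. *)
apply: hypercyclic_Sylow_tower; apply: IHm => // [|i|i p P H pip sPE pP ncycP sHP cycH oH].
- by apply: leq_trans leGEm; rewrite ltn_add2r proper_card.
- have [A hallA chA] := hallG i; exists (A :&: E)%G.
    exact: Hall_setI_normal nsEG hallA.
  rewrite /= (setIidPl (subsetIr A E)).
  exact: normal_cyclic_chainI (subsetIl A E) (subxx _) chA.
by apply: controlledS (subset_trans sHP sPE) sEG _; apply: ctrl sHP cycH oH.
Qed.

End Main.

(** * Extracting the inductive hypotheses *)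

(** A finite search that picks one of the given alternatives at each point, so neither predicate has
    to be decidable. *)
Lemma fin_exists_or_forall (T : finType) (P Q : T -> Prop) :
  (forall x, P x \/ Q x) -> (exists x, P x) \/ (forall x, Q x).
Proof.
move=> PQ; suff: (exists x, P x) \/ forall x, x \in enum T -> Q x.
  by case=> [exP | allQ]; [left | right => x; apply: allQ; rewrite mem_enum].
elim: (enum T) => [|x s [exP | allQ]]; [by right | by left | ].
case: (PQ x) => [Px | Qx]; first by left; exists x.
by right=> y; rewrite inE => /predU1P[-> | /allQ].
Qed.

Section Hypotheses.

Variables (I : Type) (sigma : I -> nat_pred) (gT : finGroupType).
Implicit Types (A B E G H K N P S T X Z : {group gT}).

Lemma cyclic_pgroup_joing (p : nat) A B H :
  p.-group H -> cyclic H -> H :=: A <*> B -> A :=: H \/ B :=: H.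
Proof.
move=> pH cycH defH.
have sAH : A \subset H by rewrite defH joing_subl.
have sBH : B \subset H by rewrite defH joing_subr.
have oA := card_pgroup (pgroupS sAH pH); have oB := card_pgroup (pgroupS sBH pH).
have [leAB | /ltnW leBA] := leqP (logn p #|A|) (logn p #|B|); [right | left].
  have sAB : A \subset B by rewrite -(cardSg_cyclic cycH sAH sBH) oA oB dvdn_exp2l.
  by rewrite defH (joing_idPr sAB).
have sBA : B \subset A by rewrite -(cardSg_cyclic cycH sBH sAH) oA oB dvdn_exp2l.
by rewrite defH (joing_idPl sBA).
Qed.

Hypothesis hsigma : prime_partition sigma.

Lemma sigma_primary_pgroup (i : I) (p : nat) (hT : finGroupType) (Q : {group hT}) :
  sigma_primary sigma Q -> p \in sigma i -> p \in \pi(Q) -> (sigma i).-group Q.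
Proof.
have [_ _ sigma_cover _] := hsigma.
move=> primQ pip piQp; apply/pnatP=> // r r_pr r_dvd.
have [j rj] := sigma_cover r r_pr.
rewrite -(primQ j i) //; first by exists r; rewrite mem_primes r_pr cardG_gt0.
by exists p.
Qed.

(** If T < G, the last proper term C k of the chain satisfies H (C k) = G. When C k is normal, G / C
    k is an image of H; otherwise G modulo the core of C k is sigma-primary, and p divides its order
    because H is not in the core. *)
Lemma weakly_m_Hset_permutable_cases (HS : {set {group gT}}) i (p : nat) H G :
    p \in sigma i -> p.-group H -> cyclic H -> H :!=: 1 -> H \subset G ->
    weakly_m_Hset_permutable sigma HS H G ->
  [\/ modular_subgroup H G, Hset_permutable HS H G
    | exists2 N : {group gT}, N <| G & (sigma i).-group (G / N) /\ ~~ (H \subset N)].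
Proof.
move=> pip pH cycH ntH sHG [T [S [[n [C [C0 Cn stepC]]] HT sHTS sSH [A [B [modA permB defS]]]]]].
have [defT | neTG] := eqVneq T G.
  have defSH : S :=: H.
    by apply/eqP; rewrite eqEsubset sSH -(setIidPl sHG) -defT.
  have [defA | defB] := cyclic_pgroup_joing pH cycH (etrans (esym defSH) defS).
    by constructor 1; rewrite -(val_inj defA).
  by constructor 2; rewrite -(val_inj defB).
constructor 3.
have exn : exists k, C k == G by exists n; rewrite Cn.
(* C k.+1 is the first term equal to G; the index 0 is excluded because C 0 = T. *)
have [[|k] /eqP Ck mink] := ex_minnP exn; first by rewrite -C0 Ck eqxx in neTG.
have ltkn : k < n by apply: mink; rewrite Cn.
have [sCk caseC] := stepC k ltkn; rewrite Ck in sCk caseC.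
have neCk : C k != G by apply/eqP=> defG; have := mink k; rewrite defG eqxx ltnn => /(_ isT).
have sTC j : j <= n -> T \subset C j.
  elim: j => [|j IHj] ltjn; first by rewrite C0.
  by have [sCj _] := stepC j ltjn; apply: subset_trans (IHj (ltnW ltjn)) sCj.
have sTCk := sTC k (ltnW ltkn).
have HCk : H * C k = G.
  by apply/eqP; rewrite eqEsubset mul_subG // -[in X in X \subset _]HT mulgS.
have nsHC : ~~ (H \subset C k).
  by apply: contra neCk => /mulSGid; rewrite HCk => defG; apply/eqP/val_inj.
case: caseC => [nsCk | primC].
  exists (C k) => //; split=> //.
  rewrite -HCk quotientMidr; apply: quotient_pgroup.
  by apply: sub_in_pnat pH => r _; rewrite inE => /eqP->.
exists (gcore (C k) G)%G; first exact: gcore_normal.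
have nsHN : ~~ (H \subset gcore (C k) G).
  by apply: contra nsHC => /subset_trans-> //; apply: gcore_sub.
split=> //; apply: sigma_primary_pgroup primC pip _.
have sHGq : H / gcore (C k) G \subset G / gcore (C k) G by apply: quotientS.
apply: (piSg sHGq); have [_ prime_sigma _ _] := hsigma.
have pHq : p.-group (H / gcore (C k) G) by apply: quotient_pgroup.
rewrite -p_rank_gt0.
have := pgroup_pdiv pHq; rewrite -subG1 quotient_sub1 ?(subset_trans sHG (gcore_norm _ _)) //.
move/(_ nsHN) => [p_pr p_dvd _]; by rewrite p_rank_gt0 mem_primes p_pr cardG_gt0.
Qed.


Variables (G E : {group gT}) (HS : {set {group gT}}).
Hypotheses (nsEG : E <| G) (hHS : complete_Hall_sigma_set sigma G HS).

Lemma supersolubly_Hall_of_set :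
    (forall A, A \in HS -> supersoluble A) ->
  supersolubly_Hall sigma G E.
Proof.
move=> supHS i; have [_ _ exHS] := hHS.
have [/hasP[p piGp pi_p] | noi] := boolP (has (mem (sigma i)) (primes #|G|)).
  have [|A [[HSA hallA] _]] := exHS i; first by exists p.
  exists A => //; have [n [C [C0 Cn stepC]]] := supHS A HSA.
  by exists n, C; rewrite Cn subsetIl.
exists 1%G; last first.
  by exists 0%N, (fun=> 1%G); rewrite subsetIl; split.
rewrite /pHall sub1G pgroup1 indexg1 /=; apply/pnatP=> // p p_pr p_dvd.
rewrite inE /=; apply: contra noi => pi_p; apply/hasP; exists p => //.
by rewrite mem_primes p_pr cardG_gt0.
Qed.

(** Some conjugate y ^ g lies in the member A of HS for the block of q, whose order is prime to that
    of Z. As H :^ g permutes with A, y ^ g normalises H :^ g. *)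
Lemma permutable_locally_normalised i H :
    (forall g, g \in G -> Hset_permutable HS (H :^ g)%G G) ->
  locally_normalised sigma i H G.
Proof.
move=> permH q y Z qi Gy qy sZG iZ sHZ nZy.
have [-> | nty] := eqVneq y 1; first exact: group1.
have [_ _ exHS] := hHS; have [_ _ sigma_cover sigma_inj] := hsigma.
have [q_pr q_dvd _] : [/\ prime q, q %| #[y] & exists m, #[y] = (q ^ m.+1)%N].
  by apply: (@pgroup_pdiv _ q <[y]>%G) => //; rewrite cycle_eq1.
have [j qj] := sigma_cover q q_pr.
have [|A [[HSA hallA] _]] := exHS j.
  by exists q; rewrite mem_primes q_pr cardG_gt0 (dvdn_trans q_dvd) ?order_dvdG.
have [Q sylQA] := Sylow_exists q A.
have sylQ : q.-Sylow(G) Q := subHall_Sylow hallA qj sylQA.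
have [|g Gg syQ] := Sylow_Jsub sylQ _ (qy : q.-group <[y]>%G).
  by rewrite cycle_subG.
have Ayg : y ^ g \in A.
  apply: (subsetP (pHall_sub sylQA)); apply: (subsetP syQ).
  by rewrite memJ_conjg cycle_id.
have coZA : coprime #|(Z :^ g)%G| #|A|.
  rewrite cardJg; apply: (pnat_coprime iZ).
  apply: sub_in_pnat (pHall_pgroup hallA) => r _ rj; rewrite inE /=.
  by apply: contra qi => ri; rewrite (sigma_inj _ _ _ ri rj).
rewrite -(memJ_conjg _ g) -normJ; have [_ /(_ A HSA) permHg] := permH g Gg.
apply: (permutable_norm (Z := (Z :^ g)%G) permHg _ Ayg coZA).
  by rewrite conjSg.
by rewrite normJ memJ_conjg.
Qed.

(** Each conjugate of H generates with the Hall subgroup A a sigma_i-group, hence lies in A; so H is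
    in the core of A. *)
Lemma permutable_sub_normal i H :
    sigma_of sigma G i ->
    (sigma i).-group H ->
    (forall g, g \in G -> Hset_permutable HS (H :^ g)%G G) ->
  exists2 N : {group gT}, N <| G & (sigma i).-group N /\ H \subset N.
Proof.
move=> sGi iH permH; have [_ _ exHS] := hHS.
have [A [[HSA hallA] _]] := exHS i sGi; have [sAG iA _] := and3P hallA.
exists (gcore A G)%G; first exact: gcore_normal.
split; first exact: pgroupS (gcore_sub A G) iA.
apply/bigcapsP=> x Gx; rewrite -sub_conjgV.
have [sHxG /(_ A HSA) permHA] := permH x^-1 (groupVr Gx).
have <- : (H :^ x^-1)%G <*> A = A.
  apply: (sub_pHall hallA); rewrite ?joing_subr ?join_subG ?sHxG //.
  by rewrite /= comm_joingE // pgroupM pgroupJ iH.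
exact: joing_subl.
Qed.

Lemma small_subgroups_controlled_of_weakly :
    (forall (i : I) (K : {group gT}),
       sigma_of sigma E i -> (sigma i).-Hall(E) K -> ~~ cyclic K ->
       (forall H : {group gT}, H \subset K -> cyclic H -> prime #|H| ->
          weakly_m_Hset_permutable sigma HS H G)
       /\
       ((forall P : {group gT}, 2.-Sylow(E) P -> ~~ abelian P) ->
        forall H : {group gT}, H \subset K -> cyclic H -> #|H| = 4 ->
          ~~ (H \subset hypercenter G) ->
          weakly_m_Hset_permutable sigma HS H G)) ->
  small_subgroups_controlled sigma G E.
Proof.
move=> hK i p P H pip sPE pP ncycP sHP cycH oH.
have [sEG nEG] := andP nsEG; have sPG := subset_trans sPE sEG.
have sHG := subset_trans sHP sPG; have pH := pgroupS sHP pP.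
have [_ _ exHS] := hHS.
have ntP : P :!=: 1 by apply: contraNneq ncycP => ->; apply: cyclic1.
have [p_pr p_dvd _] := pgroup_pdiv pP ntP.
have piEp : p \in \pi(E).
  by rewrite mem_primes p_pr cardG_gt0 (dvdn_trans p_dvd) ?cardSg.
have sEi : sigma_of sigma E i by exists p.
have sGi : sigma_of sigma G i by exists p; rewrite pip (piSg sEG).
have ntH : H :!=: 1.
  by rewrite -cardG_gt1; case: oH => [->|[_ -> _]] //; apply: prime_gt1.
have iH : (sigma i).-group H.
  by apply: sub_in_pnat pH => r _; rewrite inE => /eqP->.
have [A [[HSA hallA] _]] := exHS i sGi.
have hallAE : (sigma i).-Hall(E) (A :&: E) := Hall_setI_normal nsEG hallA.
have [Q sylQA] := Sylow_exists p (A :&: E).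
have sylQ : p.-Sylow(E) Q := subHall_Sylow hallAE pip sylQA.
have weakH g : g \in G -> weakly_m_Hset_permutable sigma HS (H :^ g)%G G
    \/ H \subset 'Z_#|G|(G).
  move=> Gg; have sPgE : (P :^ g)%G \subset E.
    by rewrite /= -(normsP nEG g Gg) conjSg.
  have pPg : p.-group (P :^ g)%G by rewrite pgroupJ.
  have [x Ex sPgQ] := Sylow_subJ sylQ sPgE pPg.
  (* A Hall subgroup of E containing P :^ g, hence not cyclic, to which the hypothesis applies. *)
  pose K := ((A :&: E) :^ x)%G.
  have sPgK : P :^ g \subset K.
    by apply: subset_trans sPgQ _; rewrite conjSg (pHall_sub sylQA).
  have hallK : (sigma i).-Hall(E) K by rewrite pHallJ.
  have ncycK : ~~ cyclic K.
    by apply: contra ncycP => cycK; rewrite -(cyclicJ P g) (cyclicS sPgK).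
  have [hK1 hK2] := hK i K sEi hallK ncycK.
  have sHgK : (H :^ g)%G \subset K.
    by apply: subset_trans sPgK; rewrite conjSg.
  have cycHg : cyclic (H :^ g)%G by rewrite cyclicJ.
  case: oH => [oH | [p2 oH nabP]].
    by left; apply: hK1; rewrite // cardJg oH.
  have [sHZ | nsHZ] := boolP ((H :^ g)%G \subset hypercenter G).
    right; move: sHZ; rewrite /= /hypercenter.
    by rewrite -{1}(normsP (ucn_norm #|G| G) g Gg) conjSg.
  left; apply: hK2 => //; last by rewrite cardJg.
  move=> R sylR; apply: contra nabP => abR.
  have p2P : 2.-group P by rewrite -p2.
  have [u Eu sPR] := Sylow_Jsub sylR sPE p2P.
  by rewrite -(abelianJ P u) (abelianS sPR).
(* Permutability with the members of HS is not invariant under conjugation, so *)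
(* it is used only when all the conjugates of H have it.                      *)
pose other H0 := [\/ modular_subgroup H0 G,
    exists2 N : {group gT}, N <| G & (sigma i).-group (G / N) /\ ~~ (H0 \subset N)
  | H \subset 'Z_#|G|(G)].
have casesH g : (g \in G /\ other (H :^ g)%G)
    \/ (g \in G -> Hset_permutable HS (H :^ g)%G G).
  have [Gg | _] := boolP (g \in G); last by right.
  have [wH | sHZ] := weakH g Gg; last by left; split=> //; constructor 3.
  have pHg : p.-group (H :^ g)%G by rewrite pgroupJ.
  have cycHg : cyclic (H :^ g)%G by rewrite cyclicJ.
  have ntHg : (H :^ g)%G :!=: 1 by rewrite -!cardG_gt1 cardJg in ntH *.
  have sHgG : (H :^ g)%G \subset G by rewrite /= -(conjGid Gg) conjSg.
  have [modH | permH | omitH] :=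
    weakly_m_Hset_permutable_cases pip pHg cycHg ntHg sHgG wH.
  - by left; split=> //; constructor 1.
  - by right.
  by left; split=> //; constructor 2.
have [[g [Gg []]] | permH] := fin_exists_or_forall casesH.
- move/(modular_subgroupJ (groupVr Gg)) => modH; constructor 1.
  have -> // : H = ((H :^ g)%G :^ g^-1)%G by apply/val_inj; rewrite /= conjsgK.
- case=> N nsNG [iGN nsHN]; constructor 3; exists N => //; split=> //.
  apply: contra nsHN => sHN.
  by rewrite /= -(normsP (normal_norm nsNG) g Gg) conjSg.
- move=> sHZ; constructor 4 => y Gy coHy; apply: (ucn_pgroup_cent pH sHZ Gy).
  have [_ p_dvdH _] := pgroup_pdiv pH ntH.
  rewrite /p_elt p'natE // -prime_coprime //.
  exact: coprime_dvdl p_dvdH coHy.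
constructor 2; split; first exact: permutable_locally_normalised.
exact: permutable_sub_normal.
Qed.

End Hypotheses.

Theorem theorem1p5 (I : Type) (sigma : I -> nat_pred)
    (hsigma : prime_partition sigma)
    (gT : finGroupType) (G E : {group gT}) (HS : {set {group gT}})
    (hG : sigma_full_Sylow_type sigma G)
    (hE : E <| G)
    (hHS : complete_Hall_sigma_set sigma G HS)
    (hsuper : forall A : {group gT}, A \in HS -> supersoluble A)
    (hK : forall (i : I) (K : {group gT}),
       sigma_of sigma E i -> (sigma i).-Hall(E) K -> ~~ cyclic K ->
       (forall H : {group gT}, H \subset K -> cyclic H -> prime #|H| ->
          weakly_m_Hset_permutable sigma HS H G)
       /\
       ((forall P : {group gT}, 2.-Sylow(E) P -> ~~ abelian P) ->
        forall H : {group gT}, H \subset K -> cyclic H -> #|H| = 4 ->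
          ~~ (H \subset hypercenter G) ->
          weakly_m_Hset_permutable sigma HS H G)) :
  hypercyclically_embedded E G.
Proof.
split=> //; have [-> | ntE] := eqsVneq E 1; [by left | right; split=> // K L].
have [_ _ sigma_cover _] := hsigma.
apply: (hypercyclic_of_controlled sigma_cover) => //.
  exact: supersolubly_Hall_of_set hHS hsuper.
exact: (small_subgroups_controlled_of_weakly hsigma hE hHS hK).
Qed.
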